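(* Let $1<p<\infty$ and let $\Omega\subseteq\mathbb{R}^N$ be an open set. Set \[ \mathcal{E}_p(\Omega)=\sup_{R>0}\lambda_p(\Omega\setminus\overline{B_R}). \] Then \[ \mathcal{E}_p(\Omega)=\inf\mathfrak{S}_{\mathrm{ess},p}(\Omega), \] where $\mathfrak{S}_{\mathrm{ess},p}(\Omega)$ is the variational essential spectrum of the Dirichlet $p$-Laplacian on $\Omega$. Moreover, if $\mathcal{E}_p(\Omega)<+\infty$, then $\mathcal{E}_p(\Omega)\in\mathfrak{S}_{\mathrm{ess},p}(\Omega)$, and thus it coincides with the minimum of $\mathfrak{S}_{\mathrm{ess},p}(\Omega)$.
   Context: Convention: $\inf\emptyset=+\infty$. $B_R=\{x\in\mathbb{R}^N: |x|<R\}$. For an open set $A\subseteq\mathbb{R}^N$, $\lambda_p(A)=\inf\{\int_A|\nabla\varphi|^p\,dx : \varphi\in C^\infty_0(A),\ \int_A|\varphi|^p\,dx=1\}$. $W^{1,p}_0(\Omega)$ is the closure of $C^\infty_0(\Omega)$ in $W^{1,p}(\Omega)$, endowed with the norm $\|\varphi\|_{W^{1,p}(\Omega)}=(\int_\Omega|\varphi|^p\,dx+\int_\Omega|\nabla\varphi|^p\,dx)^{1/p}$, and $W^{-1,p'}(\Omega)$ is its topological dual with the dual norm, $p'=p/(p-1)$. For $u\in W^{1,p}_0(\Omega)$, $-\Delta_p u\in W^{-1,p'}(\Omega)$ is defined by $\langle-\Delta_p u,\varphi\rangle=\int_\Omega\langle|\nabla u|^{p-2}\nabla u,\nabla\varphi\rangle\,dx$,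 and $|u|^{p-2}u$ is identified with the functional $\varphi\mapsto\int_\Omega|u|^{p-2}u\,\varphi\,dx$. A constrained Palais-Smale sequence at the level $\lambda\in\mathbb{R}$ is a sequence $\{u_n\}_{n\in\mathbb{N}}\subseteq W^{1,p}_0(\Omega)$ such that: (i) $\|u_n\|_{L^p(\Omega)}=1$ for every $n$; (ii) $\lim_{n\to\infty}\int_\Omega|\nabla u_n|^p\,dx=\lambda$; (iii) $\lim_{n\to\infty}\|-\Delta_p u_n-\lambda|u_n|^{p-2}u_n\|_{W^{-1,p'}(\Omega)}=0$. It is singular if $\lim_{n\to\infty}\|u_n\|_{L^p(\Omega\cap B_R)}=0$ for every $R>0$. The variational essential spectrum is $\mathfrak{S}_{\mathrm{ess},p}(\Omega)=\{\lambda : \text{there exists a singular constrained Palais-Smale sequence at the level }\lambda\}$. *)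

(* Defs.v *)
From HB Require Import structures.
From mathcomp Require Import all_boot all_order all_algebra.
From mathcomp Require Import all_classical all_reals all_analysis.

Set Implicit Arguments.
Unset Strict Implicit.
Unset Printing Implicit Defensive.
Import Order.TTheory GRing.Theory Num.Theory.
Import numFieldNormedType.Exports.

Local Open Scope classical_set_scope.
Local Open Scope ring_scope.

(* R^N is 'rV[R]_N. Its Borel sets are generated by the coordinate projections,
   as the library does for tuples. *)
Definition rV_display : measure_display -> measure_display.
Proof. exact. Qed.

Section measurable_rV.
Context (R : realType) (N : nat).

Let coords : 'I_N -> 'rV[R]_N -> R := fun i x => x 0 i.

Let rV_set0 : g_sigma_preimage coords set0.
Proof. exact: sigma_algebra0. Qed.

Let rV_setC A : g_sigma_preimage coords A -> g_sigma_preimage coords (~` A).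
Proof. exact: sigma_algebraC. Qed.

Let rV_bigcup (F : (set 'rV[R]_N)^nat) :
  (forall i, g_sigma_preimage coords (F i)) ->
  g_sigma_preimage coords (\bigcup_i (F i)).
Proof. exact: sigma_algebra_bigcup. Qed.

HB.instance Definition _ := @isMeasurable.Build
  (rV_display default_measure_display) 'rV[R]_N
  (g_sigma_preimage coords) rV_set0 rV_setC rV_bigcup.

Lemma measurable_coord (i : 'I_N) :
  measurable_fun [set: 'rV[R]_N] (fun x : 'rV[R]_N => x 0 i).
Proof.
move=> _ Y mY; rewrite setTI; apply: sub_sigma_algebra => /=.
rewrite -bigcup_seq/=; exists i => /=; first by rewrite mem_index_enum.
by exists Y => //; rewrite setTI.
Qed.

Lemma measurable_fun_coordP d (T : measurableType d) (f : T -> 'rV[R]_N) :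
  (forall i, measurable_fun setT (fun x => f x 0 i)) ->
  measurable_fun setT f.
Proof.
move=> mf _ A mA.
have : g_sigma_preimage (fun i => coords i \o f) `<=` measurable.
  apply: smallest_sub; first exact: sigma_algebra_measurable.
  rewrite -bigcup_seq; apply: bigcup_sub => i _ _ [B mB <-].
  exact: mf.
by apply; rewrite g_sigma_preimage_comp; exists A.
Qed.

End measurable_rV.

(* Lebesgue measure on R^N, by recursion on N: the Dirac mass on R^0, and the
   image of the product measure on R * R^N under (x, y) |-> (x, y_1, .., y_N)
   on R^N.+1. *)
Section lebesgue_rV.
Context (R : realType).

Definition rV_cons N (z : R * 'rV[R]_N) : 'rV[R]_N.+1 :=
  \row_i oapp (fun j => z.2 0 j) z.1 (unlift ord0 i).

Definition rV_uncons N (x : 'rV[R]_N.+1) : R * 'rV[R]_N :=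
  (x 0 ord0, \row_j x 0 (lift ord0 j)).

Lemma rV_consK N : cancel (@rV_cons N) (@rV_uncons N).
Proof.
case=> x y; rewrite /rV_uncons /rV_cons; congr pair.
  by rewrite mxE unlift_none.
by apply/rowP => j; rewrite !mxE liftK.
Qed.

Lemma measurable_rV_cons N : measurable_fun setT (@rV_cons N).
Proof.
apply: measurable_fun_coordP => i; rewrite /rV_cons.
case: (unliftP ord0 i) => [j ->|->].
  under eq_fun do rewrite mxE liftK /=.
  exact: (measurableT_comp (@measurable_coord R N j)).
by under eq_fun do rewrite mxE unlift_none /=; exact: measurable_fst.
Qed.

Lemma measurable_rV_uncons N : measurable_fun setT (@rV_uncons N).
Proof.
apply: measurable_fun_pair; first exact: measurable_coord.
apply: measurable_fun_coordP => i.
by under eq_fun do rewrite mxE; exact: measurable_coord.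
Qed.

Section step.
Context (N : nat) (mu : {sigma_finite_measure set 'rV[R]_N -> \bar R}).

Definition lebesgue_rVS : set 'rV[R]_N.+1 -> \bar R :=
  pushforward (lebesgue_measure \x mu)%E (@rV_cons N).

Let lebesgue_rVS0 : lebesgue_rVS set0 = 0%E.
Proof. by rewrite /lebesgue_rVS /pushforward preimage_set0 measure0. Qed.

Let lebesgue_rVS_ge0 A : (0 <= lebesgue_rVS A)%E.
Proof. by rewrite /lebesgue_rVS /pushforward; exact: measure_ge0. Qed.

Let lebesgue_rVS_sigma_additive : semi_sigma_additive lebesgue_rVS.
Proof.
have mcons A : measurable A -> measurable (@rV_cons N @^-1` A).
  by move=> mA; rewrite -[X in measurable X]setTI; exact: measurable_rV_cons.
move=> F mF tF mUF; rewrite /lebesgue_rVS /pushforward preimage_bigcup.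
apply: measure_semi_sigma_additive.
- by move=> k; exact: mcons.
- apply/trivIsetP => /= i j _ _ ij; rewrite -preimage_setI.
  by move/trivIsetP : tF => /(_ _ _ _ _ ij) ->//; rewrite preimage_set0.
- by rewrite -preimage_bigcup; exact: mcons.
Qed.

HB.instance Definition _ := isMeasure.Build _ _ _ lebesgue_rVS
  lebesgue_rVS0 lebesgue_rVS_ge0 lebesgue_rVS_sigma_additive.

Let lebesgue_rVS_sigma_finite : sigma_finite setT lebesgue_rVS.
Proof.
have /sigma_finiteP[F [TF ndF Foo]] := sigma_finiteT (@lebesgue_measure R).
have /sigma_finiteP[G [TG ndG Goo]] := sigma_finiteT mu.
exists (fun k => @rV_uncons N @^-1` (F k `*` G k)).
  rewrite -preimage_bigcup (_ : \bigcup_k _ = setT) ?preimage_setT//.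
  apply/seteqP; split=> // -[x y] _.
  have : setT x by [].
  have : setT y by [].
  rewrite TF TG => -[l _ Gly] [k _ Fkx].
  exists (maxn k l) => //; split => /=.
    by move: Fkx; exact/subsetPset/ndF/leq_maxl.
  by move: Gly; exact/subsetPset/ndG/leq_maxr.
move=> k; have [mF Fk] := Foo k; have [mG Gk] := Goo k; split.
  rewrite -[X in measurable X]setTI; apply: measurable_rV_uncons => //.
  exact: measurableX.
rewrite /lebesgue_rVS /pushforward -comp_preimage.
rewrite (_ : _ \o _ = id) ?preimage_id; last first.
  by apply/funext => z /=; rewrite rV_consK.
by rewrite product_measure1E// lte_mul_pinfty// ge0_fin_numE.
Qed.

HB.instance Definition _ := Measure_isSigmaFinite.Build _ _ _ lebesgue_rVS
  lebesgue_rVS_sigma_finite.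

End step.

Fixpoint lebesgue_rV (N : nat) : {sigma_finite_measure set 'rV[R]_N -> \bar R} :=
  match N with
  | 0 => dirac (0 : 'rV[R]_0)
  | N'.+1 => lebesgue_rVS (lebesgue_rV N')
  end.

End lebesgue_rV.

Section euclidean.
Context (R : realType) (N : nat).
Implicit Types x y : 'rV[R]_N.

(* The library norm on 'rV[R]_N is the sup norm: it is used here for the
   topology only, and |x| is the Euclidean norm. *)
Definition dotp x y : R := \sum_(i < N) x 0 i * y 0 i.
Definition enorm x : R := Num.sqrt (dotp x x).
Definition eball (r : R) : set 'rV[R]_N := [set x | enorm x < r].

Definition partial (i : 'I_N) (f : 'rV[R]_N -> R) : 'rV[R]_N -> R :=
  'D_(delta_mx 0 i) f.
Definition gradient (f : 'rV[R]_N -> R) (x : 'rV[R]_N) : 'rV[R]_N :=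
  \row_(i < N) partial i f x.

Definition smooth (f : 'rV[R]_N -> R) : Prop :=
  forall s : seq 'I_N, let g := foldr partial f s in
    continuous g /\ forall i x, derivable g x (delta_mx 0 i).

Definition fsupport (f : 'rV[R]_N -> R) : set 'rV[R]_N :=
  closure [set x | f x != 0].

(* C^oo_0(A), each function being extended by 0 outside A. *)
Definition test_fun (A : set 'rV[R]_N) : set ('rV[R]_N -> R) :=
  [set f | [/\ smooth f, compact (fsupport f) & fsupport f `<=` A]].

End euclidean.

Section sobolev.
Context (R : realType) (N : nat) (p : R).
Implicit Types (A : set 'rV[R]_N) (f : 'rV[R]_N -> R) (F : 'rV[R]_N -> 'rV[R]_N).

Notation mu := (lebesgue_rV R N).

Definition int_fun A f : \bar R := (\int[mu]_(x in A) (`|f x| `^ p)%:E)%E.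
Definition int_vec A F : \bar R := (\int[mu]_(x in A) (enorm (F x) `^ p)%:E)%E.

Definition Lp_norm A f : \bar R := (int_fun A f `^ p^-1)%E.
Definition W1p_norm A f F : \bar R := ((int_fun A f + int_vec A F) `^ p^-1)%E.

Definition lambda_p A : \bar R :=
  ereal_inf [set int_vec A (gradient f) | f in
    [set f | test_fun A f /\ int_fun A f = 1%E]].

Definition calE (Omega : set 'rV[R]_N) : \bar R :=
  ereal_sup [set lambda_p (Omega `\` closure (eball r)) | r in
    [set r : R | 0 < r]].

Definition weak_gradient A f F : Prop :=
  forall (psi : 'rV[R]_N -> R) (i : 'I_N), test_fun A psi ->
    \int[mu]_(x in A) (f x * partial i psi x) =
    - \int[mu]_(x in A) (F x 0 i * psi x).

(* Representatives of the elements of W^{1,p}(Omega), together with a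
   representative of the weak gradient; values outside Omega are irrelevant. *)
Record W1p (Omega : set 'rV[R]_N) := {
  W1p_fun :> 'rV[R]_N -> R;
  wgrad : 'rV[R]_N -> 'rV[R]_N;
  W1p_fun_measurable : measurable_fun Omega W1p_fun;
  wgrad_measurable : measurable_fun Omega wgrad;
  W1p_fun_Lp : (int_fun Omega W1p_fun < +oo)%E;
  wgrad_Lp : (int_vec Omega wgrad < +oo)%E;
  wgradP : weak_gradient Omega W1p_fun wgrad }.

Context (Omega : set 'rV[R]_N).

Definition W01p : set (W1p Omega) :=
  [set u : W1p Omega | forall e : R, 0 < e -> exists2 f, test_fun Omega f &
    (W1p_norm Omega (fun x => u x - f x)%R
                    (fun x => wgrad u x - gradient f x)%R < e%:E)%E].

Definition W01p_dual_norm (T : W1p Omega -> R) : \bar R :=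
  ereal_sup [set `|T phi|%:E | phi in
    [set phi : W1p Omega | W01p phi /\ (W1p_norm Omega phi (wgrad phi) <= 1)%E]].

(* When p < 2 the factors |grad u|^(p-2) and |u|^(p-2) below are 0 by
   convention at the points where grad u, resp. u, vanishes. *)
Definition minus_plaplacian (u phi : W1p Omega) : R :=
  \int[mu]_(x in Omega)
    (enorm (wgrad u x) `^ (p - 2) * dotp (wgrad u x) (wgrad phi x)).

Definition power_functional (u phi : W1p Omega) : R :=
  \int[mu]_(x in Omega) (`|u x| `^ (p - 2) * u x * phi x).

Definition constrained_palais_smale (lambda : R) (u : (W1p Omega)^nat) : Prop :=
  [/\ forall n, W01p (u n),
      forall n, Lp_norm Omega (u n) = 1%E,
      int_vec Omega (wgrad (u n)) @[n --> \oo] --> lambda%:E &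
      W01p_dual_norm (fun phi =>
        minus_plaplacian (u n) phi - lambda * power_functional (u n) phi)
        @[n --> \oo] --> 0%E].

Definition singular (u : (W1p Omega)^nat) : Prop :=
  forall r : R, 0 < r ->
    Lp_norm (Omega `&` eball r) (u n) @[n --> \oo] --> 0%E.

Definition essential_spectrum : set R :=
  [set lambda | exists2 u, constrained_palais_smale lambda u & singular u].

End sobolev.

(* Main.v *)
(* Write E for [calE p Omega] and l_r for lambda_p of Omega minus the closed ball
   of radius r; l_r increases to E.

   E is a lower bound of the spectrum: a singular sequence at the level m loses
   nothing in the limit when it is multiplied by a cutoff vanishing in the ball of
   radius r, so it produces competitors for l_r, whence l_r <= m.

   E belongs to the spectrum when it is finite: take test functions v_n supported
   outside the ball of radius 2 r_n, of unit L^p norm, with Dirichlet energy at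
   most l_(2 r_n) + o(1), where r_n tends to infinity. They form a singular
   sequence at the level E, and no variational principle is needed to see that
   it is a Palais-Smale one: the functional
   J = int |grad w|^p - l_(r_n) int |w|^p is nonnegative on test functions living
   outside the ball of radius r_n and J(v_n) tends to 0, so that the uniform
   smoothness of the p-th power forces J'(v_n) to be small on such functions.
   An arbitrary test function f may be replaced by its product with a cutoff
   equal to 1 near the support of v_n, which does not change J'(v_n) f. *)
Require Import Defs.
From mathcomp Require Import all_boot all_order all_algebra.
From mathcomp Require Import all_classical all_reals all_analysis.
From mathcomp Require Import measurable_realfun ring lra.
Set Implicit Arguments.
Unset Strict Implicit.
Unset Printing Implicit Defensive.
Import Order.TTheory GRing.Theory Num.Theory.
Import numFieldNormedType.Exports.

Local Open Scope classical_set_scope.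
Local Open Scope ring_scope.

(** * Borel sets of R^N *)

(** The obstacle is to bound J'(v) f for f living anywhere in Omega, while J is known to be
    nonnegative only on functions supported outside a ball. With g the product of f and the cutoff,
    w = v + t g is admissible, and expanding 0 <= J(w) gives -t J'(v) f <= J(v) + e t K with K
    bounded uniformly. Hence the order of choices: e first, then t from e alone, and only then n, so
    that J(v_n) is small compared with t. Three uniformities make this possible: the step t works
    for all pairs of vectors at once, the gradient of the cutoff is bounded independently of the
    radius r >= 1, and v lives beyond the radius 2 r, where the cutoff is 1. All estimates are made
    on p-th powers of norms. Minkowski and Hoelder are replaced by pointwise inequalities with a
    free parameter k, proved by comparing B with k A. In the lower bound this costs factors (1 +
    k)^p, which tend to 1 with k; this is why, assuming m < l_r, a finite l with m < l <= l_r is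
    fixed before k. *)

Section measurability.
Context (R : realType) (N : nat).

(** The sigma-algebra is generated by the coordinates, so [U] is written as the union of the boxes
    with rational centre and radius [1 / (n + 1)] that it contains; there are countably many of
    them. *)
Lemma open_measurable_rV (U : set 'rV[R]_N) : open U -> measurable U.
Proof.
move=> oU.
pose box (k : 'rV[rat]_N * nat) : set 'rV[R]_N :=
  \bigcap_(i in [set: 'I_N])
    [set x : 'rV[R]_N | `|x 0 i - ratr (k.1 0 i)| < k.2.+1%:R^-1].
pose F k := if `[< box k `<=` U >] then box k else set0.
have -> : U = \bigcup_k F k.
  apply/seteqP; split=> [x Ux|x [k _]]; last first.
    by rewrite /F; case: asboolP => // /[apply].
  have /nbhs_ballP[e /= e0 xeU] : nbhs x U by apply: open_nbhs_nbhs.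
  (* The factor 2 pays for going from [x] to a point of the box through its rational centre. *)
  have [n ne] : exists n : nat, 2 * n.+1%:R^-1 < e.
    have e20 : 0 < e / 2 by apply: divr_gt0.
    exists (Num.truncn (e / 2)^-1).
    have h : (e / 2)^-1 < (Num.truncn (e / 2)^-1).+1%:R by exact: truncnS_gt.
    rewrite mulrC -ltr_pdivlMr// -[ltRHS]invrK ltf_pV2 ?posrE ?invr_gt0//.
  have /choice[q qP] : forall i : 'I_N,
      exists q : rat, `|x 0 i - ratr q| < n.+1%:R^-1.
    move=> i; have [|q] := @rat_in_itvoo _ (x 0 i - n.+1%:R^-1) (x 0 i + n.+1%:R^-1).
      by rewrite ltrD2l gtrN.
    rewrite in_itv/= => /andP[q1 q2]; exists q.
    by rewrite ltr_norml; apply/andP; split; move: q1 q2; set r := n.+1%:R^-1; lra.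
  have bU : box (\row_i q i, n) `<=` U.
    move=> y yb; apply: xeU; split => // i j; rewrite (ord1 i).
    have /= := yb j I; rewrite mxE /ball/= => yq.
    have xq := qP j.
    rewrite (_ : _ - _ = (x 0 j - ratr (q j)) - (y 0 j - ratr (q j))); last by ring.
    apply: le_lt_trans (ler_normB _ _) _.
    by move: ne yq xq; set r := n.+1%:R^-1; lra.
  exists (\row_i q i, n) => //; rewrite /F asboolT// => i _ /=.
  by rewrite mxE.
apply: countable_bigcupT_measurable; first exact: countableP.
move=> k; rewrite /F; case: ifP => // _.
apply: fin_bigcap_measurable; first exact: finite_finset.
move=> i _.
have mf : measurable_fun [set: 'rV[R]_N]
    (fun x : 'rV[R]_N => `|x 0 i - ratr (k.1 0 i)|).
  apply: measurableT_comp => //; apply: measurable_funD => //.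
  exact: measurable_coord.
rewrite -[X in measurable X]setTI.
rewrite (_ : [set x | _] = (fun x : 'rV[R]_N => `|x 0 i - ratr (k.1 0 i)|)
    @^-1` `]-oo, (k.2.+1%:R^-1)%R[%classic).
  exact: mf.
by apply/seteqP; split=> x /=; rewrite in_itv/=.
Qed.

Lemma continuous_measurable_rV (f : 'rV[R]_N -> R) :
  continuous f -> measurable_fun [set: 'rV[R]_N] f.
Proof.
move=> cf; apply: (measurability _ (RGenOpens.measurableE R)).
move=> _ [_ [a [b ->] <-]]; apply: open_measurable_rV.
rewrite setTI.
by apply: open_comp => //; apply: interval_open.
Qed.

Lemma closed_measurable_rV (U : set 'rV[R]_N) : closed U -> measurable U.
Proof.
move=> /closed_openC/open_measurable_rV mU.
by rewrite -(setCK U); exact: measurableC.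
Qed.

Lemma measurable_fun_coord d (T : measurableType d) (D : set T) (F : T -> 'rV[R]_N) i :
  measurable_fun D F -> measurable_fun D (fun t => F t 0 i).
Proof. exact: (measurableT_comp (@measurable_coord R N i)). Qed.

Lemma measurable_dotp d (T : measurableType d) (D : set T) (F G : T -> 'rV[R]_N) :
  (forall i, measurable_fun D (fun t => F t 0 i)) ->
  (forall i, measurable_fun D (fun t => G t 0 i)) ->
  measurable_fun D (fun t => dotp (F t) (G t)).
Proof. by move=> mF mG; apply: measurable_sum => i; exact: measurable_funM. Qed.

Lemma measurable_enorm d (T : measurableType d) (D : set T) (F : T -> 'rV[R]_N) :
  (forall i, measurable_fun D (fun t => F t 0 i)) ->
  measurable_fun D (fun t => enorm (F t)).
Proof.
move=> mF; apply: (@measurableT_comp _ _ _ _ _ _ (@Num.sqrt R)).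
  by apply: continuous_measurable_fun; exact: sqrt_continuous.
exact: measurable_dotp.
Qed.

End measurability.

(** * Smooth functions *)

Section chain_rule.
Context (R : realType) (V : normedModType R).

(** Restricting to the line [h *: v + x] makes the one-variable chain rule available for directional
    derivatives. *)
Lemma is_derive1P (f : V -> R) (x v : V) (d : R) :
  is_derive x v f d <-> is_derive (0 : R) 1 (fun h : R => f (h *: v + x)) d.
Proof.
have E : 'D_v f x = 'D_1 (fun h : R => f (h *: v + x)) 0.
  rewrite /derive; set g1 := fun h => h^-1 *: _; set g2 := fun h => h^-1 *: _.
  suff -> : g1 = g2 by [].
  rewrite funeqE /g1 /g2 => h /=.
  by rewrite addr0 scale0r add0r [_%:A]mulr1.
split=> -[fx <-].
  apply: DeriveDef; last by rewrite E.
  by move/derivable1P : fx.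
apply: DeriveDef; last by rewrite E.
by apply/derivable1P.
Qed.

Lemma is_derive_comp1 (g : R -> R) (f : V -> R) (x v : V) (a d : R) :
  is_derive (f x) 1 g a -> is_derive x v f d -> is_derive x v (g \o f) (a * d).
Proof.
move=> ga /is_derive1P fd; apply/is_derive1P.
apply: (@is_derive1_comp _ g (fun h : R => f (h *: v + x)) 0 a d _ fd).
by rewrite scale0r add0r.
Qed.

End chain_rule.

(** * Functions of one variable that are flat at the origin *)

Section flat_functions.
Context (R : realType).
Implicit Types (k : nat) (x : R).

(** The factor [x^-1 ^+ k] makes the family stable under differentiation: the derivative of [flat k]
    combines [flat k.+2] and [flat k.+1]. *)
Definition flat k x : R := if 0 < x then x^-1 ^+ k * expR (- x^-1) else 0.

Lemma flat_le0 k x : x <= 0 -> flat k x = 0.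
Proof. by move=> x0; rewrite /flat ltNge x0. Qed.

Lemma flat_gt0 k x : 0 < x -> 0 < flat k x.
Proof. by move=> x0; rewrite /flat x0 mulr_gt0 ?expR_gt0// exprn_gt0 ?invr_gt0. Qed.

Lemma flat_ge0 k x : 0 <= flat k x.
Proof. by case: (ltP 0 x) => [/(flat_gt0 k)/ltW//|/(flat_le0 k)->]. Qed.

(** For positive [k], raise x / k <= exp (x / k) to the power k. *)
Lemma exprn_le_expR k x : 0 <= x -> x ^+ k <= k%:R ^+ k * expR x.
Proof.
case: k => [|k] x0; first by rewrite !expr0 mul1r -expR0 ler_expR.
rewrite -[in leRHS](mulVKf (_ : k.+1%:R != 0 :> R) x)// expRM_natl -exprMn.
rewrite lerXn2r ?nnegrE ?mulr_ge0 ?expR_ge0//.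
rewrite -ler_pdivrMl//; apply: le_trans (expR_ge1Dx _).
by rewrite lerDr.
Qed.

(** This is [exprn_le_expR] at [x^-1]. It gives differentiability at 0 and, for [k = 2], the
    constant 4 in the gradient bound of the cutoff. *)
Lemma flat_le k x : flat k x <= k%:R ^+ k.
Proof.
rewrite /flat; case: ifPn => x0; last by rewrite exprn_ge0.
rewrite expRN ler_pdivrMr ?expR_gt0//.
by apply: exprn_le_expR; rewrite invr_ge0 ltW.
Qed.

Lemma flatS k x : flat k x = x * flat k.+1 x.
Proof.
rewrite /flat; case: ifPn => x0; last by rewrite mulr0.
by rewrite exprS; field; rewrite gt_eqF.
Qed.

Lemma is_derive_flat k x :
  is_derive x 1 (flat k) (flat k.+2 x - k%:R * flat k.+1 x).
Proof.
have [x0|x0|->] := ltgtP x 0.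
- rewrite !flat_le0 ?ltW// mulr0 subr0.
  apply: (@near_eq_is_derive _ _ _ (cst 0)).
  near=> z; rewrite flat_le0//; apply/ltW; near: z; exact: lt_nbhsl.
- apply: (@near_eq_is_derive _ _ _ (fun z : R => z^-1 ^+ k * expR (- z^-1))).
    near=> z; rewrite /flat ifT//; near: z; exact: lt_nbhsr.
  have xn0 : x != 0 by rewrite gt_eqF.
  have dV : is_derive x 1 (fun z : R => z^-1) (- x^-1 ^+ 2).
    have := @is_deriveV R id x 1 1 xn0 (is_derive_id _ _).
    by rewrite /GRing.scale/= mulr1 exprVn.
  have dX : is_derive x 1 (fun z : R => z^-1 ^+ k) (k%:R * x^-1 ^+ k.-1 * - x^-1 ^+ 2).
    have := @is_deriveX _ _ _ k x 1 _ dV; rewrite /GRing.scale/=.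
    by rewrite (_ : (fun z : R => z^-1) ^+ k = (fun z => z^-1 ^+ k))// exprfctE.
  have dN : is_derive x 1 (fun z : R => - z^-1) (x^-1 ^+ 2).
    by have := @is_deriveN _ _ _ _ x 1 _ dV; rewrite opprK.
  have dE : is_derive x 1 (fun z : R => expR (- z^-1)) (expR (- x^-1) * x^-1 ^+ 2).
    exact: (@is_derive1_comp _ expR (fun z : R => - z^-1)).
  have := @is_deriveM _ _ _ _ x 1 _ _ dX dE.
  case=> dfl dE'; apply: DeriveDef => //; rewrite [LHS]dE'.
  rewrite /GRing.scale/= /flat x0.
  case: k {dX dfl dE'} => [|k]; first by rewrite /= !expr0 !exprS expr0; ring.
  by rewrite /= !exprS; ring.
(* By [flatS] used twice, the difference quotient at 0 is [h * flat k.+2 h], whose second factor is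
   bounded. *)
have cv : h^-1 *: (flat k (h + 0) - flat k 0) @[h --> 0^'] --> (0 : R).
  apply/cvgr0Pnorm_lt => e e0; near=> h.
  have h0 : h != 0 by near: h; exact: nbhs_dnbhs_neq.
  rewrite addr0 (flat_le0 k (lexx 0)) subr0 (flatS k) /GRing.scale/= mulKf// flatS.
  rewrite normrM (ger0_norm (flat_ge0 _ _)).
  apply: (@le_lt_trans _ _ (`|h| * k.+2%:R ^+ k.+2)).
    by apply: ler_wpM2l => //; exact: flat_le.
  rewrite -ltr_pdivlMr ?exprn_gt0//.
  near: h; apply: dnbhs0_lt; rewrite divr_gt0 ?exprn_gt0//.
have D0 : 'D_1 (flat k) (0 : R) = 0.
  rewrite /derive; apply/cvg_lim => //.
  by under eq_fun do rewrite /= [_%:A]mulr1.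
rewrite !flat_le0// mulr0 subr0; split; last exact: D0.
apply/cvg_ex; exists 0; under eq_fun do rewrite /= [_%:A]mulr1; exact: cv.
Unshelve. all: by end_near. Qed.

Lemma continuous_flat k : continuous (flat k).
Proof.
move=> x; apply: differentiable_continuous; apply/derivable1_diffP.
by have [] := is_derive_flat k x.
Qed.

End flat_functions.

(** * Calculus of smooth functions on R^N *)

Section smooth_functions.
Context (R : realType) (N : nat).
Implicit Types (f g : 'rV[R]_N -> R) (x : 'rV[R]_N) (i : 'I_N).

(* Being stable under partial derivatives and made of continuous, derivable
   functions, this class consists of smooth functions. *)
Inductive smooth_gen : ('rV[R]_N -> R) -> Prop :=
| smooth_gen_smooth f of smooth f : smooth_gen f
| smooth_gen_cst (c : R) : smooth_gen (fun=> c)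
| smooth_gen_coord i : smooth_gen (fun x => x 0 i)
| smooth_gen_flat k f of smooth_gen f : smooth_gen (flat k \o f)
| smooth_genD f g of smooth_gen f & smooth_gen g : smooth_gen (f + g)
| smooth_genM f g of smooth_gen f & smooth_gen g : smooth_gen (f * g).

Lemma is_derive_coord i j x :
  is_derive x (delta_mx 0 i : 'rV[R]_N) (fun x : 'rV[R]_N => x 0 j) (i == j)%:R.
Proof.
apply/is_derive1P.
rewrite (_ : (fun h : R => _) = (fun h : R => h * (i == j)%:R + x 0 j)); last first.
  by apply/funext => h; rewrite !mxE eqxx/= eq_sym.
set a := (i == j)%:R.
have := is_deriveD (is_deriveM (is_derive_id (0 : R) (1 : R))
  (is_derive_cst a (0 : R) (1 : R))) (is_derive_cst (x 0 j) (0 : R) (1 : R)).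
case=> d1 d2; apply: DeriveDef => //.
by rewrite [LHS]d2 /GRing.scale/= mul0r add0r addr0 mulr1.
Qed.

Lemma smooth_partial f i : smooth f -> smooth (partial i f).
Proof. by move=> sf s /=; have := sf (rcons s i); rewrite foldr_rcons. Qed.

Lemma smooth_continuous f : smooth f -> continuous f.
Proof. by move=> /(_ [::])[]. Qed.

Lemma smooth_is_derive f i x : smooth f ->
  is_derive x (delta_mx 0 i) f (partial i f x).
Proof. by move=> /(_ [::])[_ /(_ i x)] df; apply: DeriveDef. Qed.

Lemma smooth_genP f : smooth_gen f ->
  continuous f /\ forall i, exists2 g, smooth_gen g &
    forall x, is_derive x (delta_mx 0 i) f (g x).
Proof.
elim=> {f} [f sf|c|j|k f sf [cf df]|f g sf [cf df] sg [cg dg]|f g sf [cf df] sg [cg dg]].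
- split=> [|i]; first exact: smooth_continuous.
  by exists (partial i f) => [|x]; [apply/smooth_gen_smooth/smooth_partial|exact: smooth_is_derive].
- split=> [|i]; first exact: cst_continuous.
  exists (fun=> 0) => [|x]; first exact: smooth_gen_cst.
  exact: is_derive_cst.
- split=> [|i]; first exact: coord_continuous.
  exists (fun=> (i == j)%:R) => [|x]; first exact: smooth_gen_cst.
  exact: is_derive_coord.
- split=> [|i].
    by move=> x; apply: continuous_comp; [exact: cf|exact: continuous_flat].
  have [h sh dh] := df i.
  exists (((flat k.+2 \o f) + (fun=> - k%:R) * (flat k.+1 \o f)) * h) => [|x].
    apply: smooth_genM => //; apply: smooth_genD; first exact: smooth_gen_flat.
    by apply: smooth_genM; [exact: smooth_gen_cst|exact: smooth_gen_flat].
  rewrite [X in is_derive _ _ _ X](_ : _ = (flat k.+2 (f x) - k%:R * flat k.+1 (f x)) * h x).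
    by apply: is_derive_comp1 => //; exact: is_derive_flat.
  by rewrite !fctE /= mulNr.
- split=> [|i]; first by move=> x; apply: continuousD; [exact: cf|exact: cg].
  have [h sh dh] := df i; have [l sl dl] := dg i.
  exists (h + l) => [|x]; first exact: smooth_genD.
  exact: is_deriveD.
- split=> [|i]; first by move=> x; apply: continuousM; [exact: cf|exact: cg].
  have [h sh dh] := df i; have [l sl dl] := dg i.
  exists (f * l + g * h) => [|x]; first by apply: smooth_genD; exact: smooth_genM.
  exact: is_deriveM.
Qed.

Lemma smooth_gen_partial f i : smooth_gen f -> smooth_gen (partial i f).
Proof.
move=> /smooth_genP[_ /(_ i)[g sg dg]].
by rewrite (_ : partial i f = g)//; apply/funext => x; have [] := dg x.
Qed.

Lemma smooth_genW f : smooth_gen f -> smooth f.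
Proof.
move=> sf s /=; have : smooth_gen (foldr (@partial R N) f s).
  by elim: s => //= i s; exact: smooth_gen_partial.
move=> /smooth_genP[cg dg]; split => // i x.
by have [h _ /(_ x)[]] := dg i.
Qed.

Lemma smoothD f g : smooth f -> smooth g -> smooth (f + g).
Proof.
by move=> sf sg; apply/smooth_genW/smooth_genD; exact: smooth_gen_smooth.
Qed.

Lemma smoothM f g : smooth f -> smooth g -> smooth (f * g).
Proof.
by move=> sf sg; apply/smooth_genW/smooth_genM; exact: smooth_gen_smooth.
Qed.

Lemma smooth_cst (c : R) : smooth ((fun=> c) : 'rV[R]_N -> R).
Proof. exact/smooth_genW/smooth_gen_cst. Qed.

Lemma gradientD f g x : smooth f -> smooth g ->
  gradient (f + g) x = gradient f x + gradient g x.
Proof.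
move=> sf sg; apply/rowP => i; rewrite !mxE.
have := is_deriveD (smooth_is_derive i x sf) (smooth_is_derive i x sg).
by move=> [].
Qed.

Lemma gradientM f g x : smooth f -> smooth g ->
  gradient (f * g) x = f x *: gradient g x + g x *: gradient f x.
Proof.
move=> sf sg; apply/rowP => i; rewrite !mxE.
have := is_deriveM (smooth_is_derive i x sf) (smooth_is_derive i x sg).
by move=> [].
Qed.

Lemma gradientZ (c : R) f x : smooth f ->
  gradient (fun x => c * f x) x = c *: gradient f x.
Proof.
move=> sf; rewrite (_ : (fun x => _) = (fun=> c) * f)// gradientM//; last exact: smooth_cst.
rewrite [X in _ + _ *: X](_ : _ = 0) ?scaler0 ?addr0//.
by apply/rowP => i; rewrite !mxE /partial derive_cst.
Qed.

Lemma smoothZ (c : R) f : smooth f -> smooth (fun x => c * f x).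
Proof. by move=> sf; apply: (smoothM (smooth_cst c) sf). Qed.

Lemma continuous_partial f i : smooth f -> continuous (partial i f).
Proof. by move=> /(@smooth_partial _ i)/smooth_continuous. Qed.

Lemma measurable_gradient f : smooth f -> measurable_fun setT (gradient f).
Proof.
move=> sf; apply: measurable_fun_coordP => i; under eq_fun do rewrite mxE.
by apply: continuous_measurable_rV; exact: continuous_partial.
Qed.

End smooth_functions.

(** * Lebesgue measure on R^N *)

Section cubes.
Context (R : realType).

(** Cubes are preferred to Euclidean balls because their preimage under [rV_cons] is a product,
    which suits the recursive definition of [lebesgue_rV]. *)
Definition cube N (M : R) : set 'rV[R]_N := [set x | forall i, `|x 0 i| <= M].

Lemma cubeE N (M : R) :
  @cube N M = [set x : 'rV[R]_N | forall i, `[-M, M]%classic (x ord0 i)].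
Proof.
apply/seteqP; split=> x /= xM i; have := xM i; rewrite in_itv/= ler_norml//.
Qed.

Lemma compact_cube N (M : R) : compact (@cube N M).
Proof.
rewrite cubeE; apply: (@rV_compact _ _ (fun=> `[-M, M]%classic)) => i.
exact: segment_compact.
Qed.

Lemma closed_cube N (M : R) : closed (@cube N M).
Proof. by apply: compact_closed; [exact: norm_hausdorff|exact: compact_cube]. Qed.

Lemma measurable_cube N (M : R) : measurable (@cube N M).
Proof. by apply: closed_measurable_rV; exact: closed_cube. Qed.

Lemma preimage_cube N (M : R) :
  @rV_cons R N @^-1` @cube N.+1 M = `[-M, M]%classic `*` @cube N M.
Proof.
apply/seteqP; split=> -[x y] /=.
  move=> xy; split => [|i].
    by have := xy ord0; rewrite /rV_cons mxE unlift_none/= in_itv/= ler_norml.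
  by have := xy (lift ord0 i); rewrite /rV_cons mxE liftK.
rewrite in_itv/= -ler_norml => -[xM yM] i; rewrite /rV_cons mxE.
by case: (unliftP ord0 i) => [j _|_] //=; exact: yM.
Qed.

Lemma lebesgue_rV_cube N (M : R) : (lebesgue_rV R N (cube M) < +oo)%E.
Proof.
elim: N => [|N IH]; first by rewrite /= diracE ltry.
rewrite /= /lebesgue_rVS /pushforward preimage_cube.
rewrite product_measure1E//; last exact: measurable_cube.
rewrite lte_mul_pinfty//.
rewrite ge0_fin_numE//.
have : (lebesgue_measure (`[(- M)%R, M]%classic : set R) < +oo)%E.
  by rewrite lebesgue_measure_itv/=; case: ifP => // _; rewrite -EFinB ltry.
by [].
Qed.

(** A form of bounded support that passes, with the same [M], to partial derivatives and to slices
    in fewer variables. *)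
Definition vanishes_outside N (M : R) (f : 'rV[R]_N -> R) :=
  forall x, ~ cube M x -> f x = 0.

Lemma continuous_cube_bounded N (M : R) (f : 'rV[R]_N -> R) :
  continuous f -> vanishes_outside M f -> exists K, forall x, `|f x| <= K.
Proof.
move=> cf f0.
have /compact_bounded[K [_ fK]] : compact (f @` cube M).
  apply: continuous_compact; last exact: compact_cube.
  exact: continuous_subspaceT.
exists (`|K| + 1) => x.
have [xM|xM] := pselect (cube M x); last by rewrite f0// normr0 addr_ge0.
by apply: (fK (`|K| + 1)); [rewrite ltr_pwDr// ler_norm|exists x].
Qed.

Lemma bounded_integrable_cube N (M K : R) (f : 'rV[R]_N -> R) :
  measurable_fun setT f -> (forall x, `|f x| <= K) -> vanishes_outside M f ->
  (lebesgue_rV R N).-integrable setT (EFin \o f).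
Proof.
move=> mf fK f0.
have -> : EFin \o f = (EFin \o f) \_ (cube M).
  apply/funext => x; rewrite /patch; case: ifPn => //.
  by rewrite notin_setE => xM; rewrite /= f0.
apply: (proj1 (integrable_mkcond _ (measurable_cube _))).
apply: measurable_bounded_integrable.
- exact: measurable_cube.
- exact: lebesgue_rV_cube.
- exact: measurable_funTS.
- by exists K; split; [exact: num_real|move=> x Kx y _ /=; apply: le_trans (fK y) (ltW Kx)].
Qed.

Lemma integrable_cube N (M : R) (f : 'rV[R]_N -> R) :
  continuous f -> vanishes_outside M f ->
  (lebesgue_rV R N).-integrable setT (EFin \o f).
Proof.
move=> cf f0; have [K fK] := continuous_cube_bounded cf f0.
exact: bounded_integrable_cube (continuous_measurable_rV cf) fK f0.
Qed.

Lemma vanishes_outside_partial N (M : R) (f : 'rV[R]_N -> R) i :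
  vanishes_outside M f -> vanishes_outside M (partial i f).
Proof.
move=> f0 x xM; rewrite /partial (@near_eq_derive _ _ _ f (cst 0)) ?derive_cst//.
have : nbhs x (~` cube M).
  by apply: open_nbhs_nbhs; split => //; apply/closed_openC/closed_cube.
by apply: filterS => z /f0.
Qed.

End cubes.

(** * The integral of a compactly supported partial derivative vanishes *)

Section integral_partial.
Context (R : realType).

Lemma continuous_rV_cons N (z : R * 'rV[R]_N) : {for z, continuous (@rV_cons R N)}.
Proof.
apply/cvg_ballP => e e0.
exists (ball z.1 e, ball z.2 e); first by split; exact: nbhsx_ballx.
move=> w [w1 w2]; split => // i j; rewrite !mxE.
by case: (unliftP ord0 j) => [k _|_]//=; case: w2.
Qed.

Lemma continuous_pairl (T U : topologicalType) (y : U) :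
  continuous (fun x : T => (x, y)).
Proof.
move=> x A [[B C] [/= Bx Cy] BCA]; apply: filterS Bx => z Bz.
by apply: BCA; split => //=; exact: nbhs_singleton.
Qed.

Lemma continuous_pairr (T U : topologicalType) (x : T) :
  continuous (fun y : U => (x, y)).
Proof.
move=> y A [[B C] [/= Bx Cy] BCA]; apply: filterS Cy => z Cz.
by apply: BCA; split => //=; exact: nbhs_singleton.
Qed.

Lemma rV_consD0 N (x h : R) (y : 'rV[R]_N) :
  rV_cons (h *: 1 + x, y) = h *: delta_mx 0 ord0 + rV_cons (x, y).
Proof.
apply/rowP => i; rewrite !mxE; case: (unliftP ord0 i) => [k ->|->] /=.
  by rewrite mulr0 add0r.
by [].
Qed.

Lemma rV_consDS N (x h : R) (y : 'rV[R]_N) j :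
  rV_cons (x, h *: delta_mx 0 j + y) = h *: delta_mx 0 (lift ord0 j) + rV_cons (x, y).
Proof.
apply/rowP => i; rewrite !mxE; case: (unliftP ord0 i) => [k ->|->] /=.
  by rewrite !mxE /= (inj_eq (@lift_inj _ _)).
by rewrite mulr0 add0r.
Qed.

Lemma is_derive_rV_cons0 N (f : 'rV[R]_N.+1 -> R) x (y : 'rV[R]_N) d :
  is_derive (rV_cons (x, y)) (delta_mx 0 ord0) f d ->
  is_derive x 1 (fun x => f (rV_cons (x, y))) d.
Proof.
move=> /is_derive1P df; apply/is_derive1P.
by under eq_fun do rewrite rV_consD0.
Qed.

Lemma is_derive_rV_consS N (f : 'rV[R]_N.+1 -> R) x (y : 'rV[R]_N) j d :
  is_derive (rV_cons (x, y)) (delta_mx 0 (lift ord0 j)) f d ->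
  is_derive y (delta_mx 0 j) (fun y => f (rV_cons (x, y))) d.
Proof.
move=> /is_derive1P df; apply/is_derive1P.
by under eq_fun do rewrite rV_consDS.
Qed.

Lemma integral_derive_compact (F f : R -> R) (M : R) : continuous f ->
  (forall x : R, is_derive x 1 F (f x)) ->
  (forall x, M < `|x| -> F x = 0) -> (forall x, M < `|x| -> f x = 0) ->
  (\int[lebesgue_measure]_x (f x)%:E = 0)%E.
Proof.
move=> cf dF F0 f0.
have cF : continuous F.
  move=> x; apply: differentiable_continuous; apply/derivable1_diffP.
  by have [] := dF x.
(* Positive and larger than [M] even if [M] is negative, so [F] vanishes at both ends of the
   interval. *)
pose L := `|M| + 1.
have L0 : 0 < L by rewrite ltr_wpDl.
have ML : M < L by rewrite ltr_pwDr// ler_norm.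
have E : (\int[lebesgue_measure]_(x in `[(- L)%R, L]) (f x)%:E = (F L)%:E - (F (- L))%:E)%E.
  apply: continuous_FTC2; first by rewrite gtrN.
  - exact: continuous_subspaceT.
  - split; first by move=> x _; have [] := dF x.
      by apply: cvg_at_right_filter; exact: cF.
    by apply: cvg_at_left_filter; exact: cF.
  - by move=> x _; rewrite derive1E; have [] := dF x.
rewrite !F0 ?normrN ?gtr0_norm// subee// in E.
rewrite -[RHS]E [RHS]integral_mkcond; apply: eq_integral => x _.
rewrite /patch; case: ifPn => //; rewrite notin_setE/= in_itv/= -ler_norml => /negP.
by rewrite -ltNge => Lx; rewrite f0// (lt_trans ML).
Qed.

(** Induction on [N] with Fubini, integrating first in the variables that contain the i-th one: by
    the induction hypothesis when this is one of the last [N] coordinates, by the fundamental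
    theorem of calculus when it is the first. *)
Lemma integral_partial_eq0 N i (f : 'rV[R]_N -> R) (M : R) :
  continuous f -> continuous (partial i f) ->
  (forall x, derivable f x (delta_mx 0 i)) -> vanishes_outside M f ->
  (\int[lebesgue_rV R N]_x (partial i f x)%:E = 0)%E.
Proof.
elim: N => [|N IH] in i f *; first by case: i.
move=> cf cdf df f0.
have dP x : is_derive x (delta_mx 0 i) f (partial i f x) by apply: DeriveDef.
have df0 := @vanishes_outside_partial _ _ _ _ i f0.
have idf := integrable_cube cdf df0.
have mcons := @measurable_rV_cons R N.
have mdf : measurable_fun setT (EFin \o partial i f).
  by apply/measurable_EFinP; exact: continuous_measurable_rV.
have iprod : (lebesgue_measure \x lebesgue_rV R N)%E.-integrable setT
    ((EFin \o partial i f) \o @rV_cons R N).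
  apply/integrableP; split; first exact: measurableT_comp.
  move/integrableP : idf => [_]; rewrite /= /lebesgue_rVS.
  rewrite ge0_integral_pushforward//.
  apply/measurable_EFinP; apply: measurableT_comp => //.
  exact: continuous_measurable_rV.
rewrite /= /lebesgue_rVS integral_pushforward//= preimage_setT.
have cube1 (x : R) (y : 'rV[R]_N) : M < `|x| -> ~ cube M (rV_cons (x, y)).
  move=> Mx /(_ ord0); rewrite /rV_cons mxE unlift_none/=.
  by rewrite leNgt Mx.
have cube2 (x : R) (y : 'rV[R]_N) : ~ cube M y -> ~ cube M (rV_cons (x, y)).
  move=> yM xy; apply: yM => j; have := xy (lift ord0 j).
  by rewrite /rV_cons mxE liftK.
have cx (g : 'rV[R]_N.+1 -> R) (y : 'rV[R]_N) : continuous g ->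
    continuous (fun x => g (rV_cons (x, y))).
  move=> cg x; apply: (@continuous_comp _ _ _ (fun x => rV_cons (x, y)) g); last exact: cg.
  apply: (@continuous_comp _ _ _ (fun x => (x, y)) (@rV_cons R N)); last exact: continuous_rV_cons.
  exact: continuous_pairl.
have cy (g : 'rV[R]_N.+1 -> R) (x : R) : continuous g ->
    continuous (fun y : 'rV[R]_N => g (rV_cons (x, y))).
  move=> cg y; apply: (@continuous_comp _ _ _ (fun y => rV_cons (x, y)) g); last exact: cg.
  apply: (@continuous_comp _ _ _ (fun y => (x, y)) (@rV_cons R N)); last exact: continuous_rV_cons.
  exact: continuous_pairr.
case: (unliftP ord0 i) => [j|] ij; subst i.
  rewrite -(integral12_prod_meas1 iprod) integral0_eq// => x _.
  rewrite /fubini_F/=.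
  have dj : partial j (fun y : 'rV[R]_N => f (rV_cons (x, y))) =
      fun y => partial (lift ord0 j) f (rV_cons (x, y)).
    by apply/funext => y; have [] := is_derive_rV_consS (dP (rV_cons (x, y))).
  rewrite -[RHS](IH j (fun y => f (rV_cons (x, y)))).
  - by apply: eq_integral => y _; rewrite dj.
  - exact: cy.
  - by rewrite dj; exact: cy.
  - by move=> y; have [] := is_derive_rV_consS (dP (rV_cons (x, y))).
  - by move=> y yM; rewrite f0//; exact: cube2.
rewrite -(integral21_prod_meas1 iprod) integral0_eq// => y _.
rewrite /fubini_G/=.
apply: (@integral_derive_compact (fun x => f (rV_cons (x, y))) _ M).
- exact: cx.
- by move=> x; exact: is_derive_rV_cons0.
- by move=> x Mx; rewrite f0//; exact: cube1.
- by move=> x Mx; rewrite df0//; exact: cube1.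
Qed.

End integral_partial.

(** * Euclidean norm and powers *)

Section euclidean_norm.
Context (R : realType) (N : nat).
Implicit Types (x y z : 'rV[R]_N) (a : R).

Lemma dotpC x y : dotp x y = dotp y x.
Proof. by apply: eq_bigr => i _; rewrite mulrC. Qed.

Lemma dotpDr x y z : dotp x (y + z) = dotp x y + dotp x z.
Proof. by rewrite /dotp -big_split; apply: eq_bigr => i _; rewrite mxE mulrDr. Qed.

Lemma dotpZr a x y : dotp x (a *: y) = a * dotp x y.
Proof. by rewrite /dotp mulr_sumr; apply: eq_bigr => i _; rewrite mxE mulrCA. Qed.

Lemma dotpDl x y z : dotp (x + y) z = dotp x z + dotp y z.
Proof. by rewrite dotpC dotpDr !(dotpC z). Qed.

Lemma dotpZl a x y : dotp (a *: x) y = a * dotp x y.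
Proof. by rewrite dotpC dotpZr dotpC. Qed.

Lemma dotp_ge0 x : 0 <= dotp x x.
Proof. by apply: sumr_ge0 => i _; rewrite -expr2 sqr_ge0. Qed.

Lemma dotp0 x : dotp x 0 = 0.
Proof. by rewrite -(scale0r 0) dotpZr mul0r. Qed.

Lemma enorm_ge0 x : 0 <= enorm x.
Proof. exact: sqrtr_ge0. Qed.

Lemma sqr_enorm x : enorm x ^+ 2 = dotp x x.
Proof. by rewrite sqr_sqrtr ?dotp_ge0. Qed.

Lemma enorm0 : enorm (0 : 'rV[R]_N) = 0.
Proof. by rewrite /enorm dotp0 sqrtr0. Qed.

Lemma enormZ a x : enorm (a *: x) = `|a| * enorm x.
Proof. by rewrite /enorm dotpZl dotpZr mulrA -expr2 sqrtrM ?sqr_ge0// sqrtr_sqr. Qed.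

Lemma enorm_eq0 x : enorm x = 0 -> x = 0.
Proof.
move=> x0; have /eqP : dotp x x = 0 by rewrite -sqr_enorm x0 expr0n.
rewrite psumr_eq0 => [/allP x0'|i _]; last by rewrite -expr2 sqr_ge0.
apply/rowP => i; rewrite mxE; apply/eqP.
by have := x0' i (mem_index_enum _); rewrite /= mulf_eq0 orbb.
Qed.

Lemma normr_dotp x y : `|dotp x y| <= enorm x * enorm y.
Proof.
have [/enorm_eq0->|x0] := eqVneq (enorm x) 0.
  by rewrite dotpC dotp0 normr0 enorm0 mul0r.
have {}x0 : 0 < enorm x by rewrite lt_def x0 enorm_ge0.
(* This square expands to |x|^2 times |x|^2 |y|^2 - (x . y)^2. *)
have := dotp_ge0 (enorm x ^+ 2 *: y - dotp x y *: x).
rewrite -scaleNr !(dotpDl, dotpDr, dotpZl, dotpZr) -!sqr_enorm (dotpC y x).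
set c := dotp x y; set A := enorm x; set B := enorm y => H.
have : 0 <= A ^+ 2 * ((A * B) ^+ 2 - c ^+ 2).
  by apply: le_trans H _; rewrite le_eqVlt; apply/orP; left; apply/eqP; ring.
rewrite pmulr_rge0 ?exprn_gt0// subr_ge0 -[c ^+ 2]real_normK ?num_real//.
by rewrite ler_sqr// nnegrE mulr_ge0 ?enorm_ge0.
Qed.

Lemma enormD x y : enorm (x + y) <= enorm x + enorm y.
Proof.
rewrite -ler_sqr ?nnegrE ?addr_ge0 ?enorm_ge0// sqr_enorm dotpDl !dotpDr.
rewrite -!sqr_enorm (dotpC y x).
have := le_trans (ler_norm _) (normr_dotp x y); nra.
Qed.

Lemma enormN x : enorm (- x) = enorm x.
Proof. by rewrite -scaleN1r enormZ normrN1 mul1r. Qed.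

Lemma continuous_dotp (T : topologicalType) (F : T -> 'rV[R]_N) :
  (forall i, continuous (fun t => F t 0 i)) -> continuous (fun t => dotp (F t) (F t)).
Proof.
move=> cF; rewrite /dotp; elim: (index_enum _) => [|i s IH].
  rewrite (_ : (fun t : T => _) = fun=> 0); first exact: cst_continuous.
  by apply/funext => y; rewrite big_nil.
rewrite (_ : (fun t : T => _) = (fun t : T => F t 0 i) * (fun t : T => F t 0 i) +
    (fun t : T => \sum_(i <- s) F t 0 i * F t 0 i)).
  move=> t; apply: continuousD; last exact: IH.
  by apply: continuousM; exact: cF.
by apply/funext => y; rewrite big_cons.
Qed.

Lemma continuous_enorm (T : topologicalType) (F : T -> 'rV[R]_N) :
  (forall i, continuous (fun t => F t 0 i)) -> continuous (fun t => enorm (F t)).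
Proof.
move=> cF t; apply: (@continuous_comp _ _ _ (fun t => dotp (F t) (F t))); last first.
  exact: sqrt_continuous.
exact: continuous_dotp.
Qed.

End euclidean_norm.

(** * Pointwise inequalities for real powers *)

Section power_inequalities.
Context (R : realType) (p : R).
Hypothesis p_gt1 : 1 < p.

Let p0 : 0 < p. Proof. exact: lt_trans p_gt1. Qed.
Let p1 : 0 < p - 1. Proof. by rewrite subr_gt0. Qed.

Lemma powRB1M (A : R) : 0 <= A -> A `^ p = A `^ (p - 1) * A.
Proof.
rewrite le_eqVlt => /predU1P[<-|A0]; first by rewrite mulr0 powR0 ?gt_eqF.
by rewrite -[X in _ * X](powRr1 (ltW A0)) -powRD ?subrK// (gt_eqF A0) implybT.
Qed.

(** At [A = 0] the left side is 0 because [p - 1] is nonzero, and the factor [A] kills the right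
    side whatever value the power with exponent [p - 2] takes there. *)
Lemma powRB2M (A : R) : 0 <= A -> A `^ (p - 1) = A `^ (p - 2) * A.
Proof.
rewrite le_eqVlt => /predU1P[<-|A0]; first by rewrite mulr0 powR0 ?gt_eqF.
rewrite -[X in _ * X](powRr1 (ltW A0)) -powRD ?(gt_eqF A0) ?implybT//.
by congr (_ `^ _); ring.
Qed.

Lemma powR_oppV_power (a : R) : 0 < a -> (a `^ (- p^-1)) `^ p = a^-1.
Proof. by move=> a0; rewrite -powRrM mulNr mulVf ?gt_eqF// powRN powRr1 ?ltW. Qed.

(** If [B <= k * A] the sum is at most [(1 + k) * A], otherwise at most [(1 + k^-1) * B]. A small
    [k] keeps the first constant close to 1. *)
Lemma powR_addr_le (A B k : R) : 0 <= A -> 0 <= B -> 0 < k ->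
  (A + B) `^ p <= (1 + k) `^ p * A `^ p + (1 + k^-1) `^ p * B `^ p.
Proof.
move=> A0 B0 k0; have k10 : 0 <= k^-1 by rewrite invr_ge0 ltW.
have k1 : 0 <= 1 + k by rewrite addr_ge0// ltW.
have k11 : 0 <= 1 + k^-1 by rewrite addr_ge0.
rewrite -!powRM//; have [BA|AB] := leP B (k * A).
  apply: (@le_trans _ _ (((1 + k) * A) `^ p)); last by rewrite lerDl powR_ge0.
  apply: ge0_ler_powR; rewrite ?nnegrE ?addr_ge0 ?mulr_ge0// ?(ltW p0)//.
  by rewrite mulrDl mul1r lerD2l.
apply: (@le_trans _ _ (((1 + k^-1) * B) `^ p)); last by rewrite lerDr powR_ge0.
apply: ge0_ler_powR; rewrite ?nnegrE ?addr_ge0 ?mulr_ge0// ?(ltW p0)//.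
by rewrite mulrDl mul1r addrC lerD2l ler_pdivlMl// ltW.
Qed.

(** Same dichotomy: either [B] is at most [k * A], or [A] is at most [k^-1 * B] in the factor of
    exponent [p - 1]. *)
Lemma powR_young (A B k : R) : 0 <= A -> 0 <= B -> 0 < k ->
  A `^ (p - 1) * B <= k * A `^ p + (k^-1) `^ (p - 1) * B `^ p.
Proof.
move=> A0 B0 k0; have k10 : 0 <= k^-1 by rewrite invr_ge0 ltW.
rewrite !powRB1M//; have [BA|AB] := leP B (k * A).
  rewrite -[leLHS]addr0 lerD ?mulr_ge0 ?powR_ge0//.
  by rewrite mulrCA; apply: ler_wpM2l BA; rewrite powR_ge0.
rewrite -[leLHS]add0r lerD ?mulr_ge0 ?powR_ge0 ?(ltW k0)//.
rewrite mulrA -powRM//; apply: ler_wpM2r => //.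
by apply: ge0_ler_powR; rewrite ?nnegrE ?mulr_ge0 ?(ltW p1)// ler_pdivlMl// ltW.
Qed.

Lemma powR_young1 (A B : R) : 0 <= A -> 0 <= B ->
  A `^ (p - 1) * B <= A `^ p + B `^ p.
Proof.
by move=> A0 B0; have := powR_young A0 B0 ltr01; rewrite invr1 powR1 !mul1r.
Qed.

Lemma powRB2_abs_le (A B c : R) : 0 <= A -> `|c| <= A * B ->
  `|A `^ (p - 2) * c| <= A `^ (p - 1) * B.
Proof.
move=> A0 cAB; rewrite normrM ger0_norm ?powR_ge0// powRB2M// -mulrA.
by apply: ler_wpM2l => //; rewrite powR_ge0.
Qed.

Lemma powR_taylor1 (q e : R) : 0 < e -> exists2 d : R, 0 < d &
  forall y : R, `|y| <= d -> `|(1 + y) `^ q - 1 - q * y| <= e * `|y|.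
Proof.
move=> e0; have [dq Dq] := is_derive1_powR q (@ltr01 R).
have : h^-1 *: ((h *: 1 + 1) `^ q - 1 `^ q) @[h --> 0^'] --> q * 1 `^ (q - 1).
  by rewrite -Dq; exact: dq.
rewrite !powR1 mulr1 => /cvgrPdist_le/(_ e e0).
rewrite near_withinE => -[/= d d0 Hd].
exists (d / 2) => [|y yd]; first by rewrite divr_gt0.
have [->|y0] := eqVneq y 0.
  by rewrite addr0 powR1 subrr mulr0 subr0 !normr0 mulr0.
have yd' : `|0 - y| < d by rewrite sub0r normrN; move: yd; lra.
have := Hd y yd' y0; rewrite [y%:A]mulr1 /GRing.scale/=.
rewrite -ler_pdivrMr ?normr_gt0// -normf_div distrC addrC; congr (`|_| <= e).
by rewrite (addrC y 1); field.
Qed.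

Lemma powR_expand_far (A B c t k : R) : 0 <= A -> 0 <= B -> `|c| <= A * B ->
  0 < t -> 0 < k -> k * A < t * B ->
  `|(A ^+ 2 + 2 * t * c + t ^+ 2 * B ^+ 2) `^ (p / 2) - A `^ p
    - p * t * (A `^ (p - 2) * c)|
  <= ((1 + k^-1) `^ p + p * k^-1 `^ (p - 1)) * t `^ (p - 1) * (t * B `^ p).
Proof.
move=> A0 B0 cAB t0 k0 kAtB.
have k10 : 0 <= k^-1 by rewrite invr_ge0 ltW.
have tB0 : 0 <= t * B by rewrite mulr_ge0// ltW.
have AtB : A <= k^-1 * (t * B) by rewrite ler_pdivlMl// ltW.
have E : ((1 + k^-1) `^ p + p * k^-1 `^ (p - 1)) * t `^ (p - 1) * (t * B `^ p) =
    ((1 + k^-1) * (t * B)) `^ p + p * t * ((k^-1 * (t * B)) `^ (p - 1) * B).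
  rewrite !powRM ?addr_ge0 ?(ltW t0)//; rewrite (powRB1M B0) (powRB1M (ltW t0)); ring.
rewrite {}E; apply: le_trans (ler_normB _ _) _; apply: lerD; last first.
  rewrite normrM ger0_norm ?mulr_ge0 ?(ltW p0) ?(ltW t0)//.
  apply: ler_wpM2l; first by rewrite mulr_ge0 ?(ltW p0) ?(ltW t0).
  apply: le_trans (powRB2_abs_le A0 cAB) _; apply: ler_wpM2r => //.
  by apply: ge0_ler_powR; rewrite ?nnegrE ?mulr_ge0 ?(ltW p1) ?(ltW t0).
have /andP[c1 c2] : - (A * B) <= c <= A * B by rewrite -ler_norml.
(* The expression is (A - t B)^2 + 2 t (A B + c). *)
have V0 : 0 <= A ^+ 2 + 2 * t * c + t ^+ 2 * B ^+ 2.
  have : 0 <= (A - t * B) ^+ 2 by exact: sqr_ge0.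
  have : 0 <= t * (A * B + c) by rewrite mulr_ge0 ?(ltW t0)//; lra.
  nra.
set Z := (1 + k^-1) * (t * B).
have Z0 : 0 <= Z by rewrite mulr_ge0 ?addr_ge0.
have VZ : (A ^+ 2 + 2 * t * c + t ^+ 2 * B ^+ 2) `^ (p / 2) <= Z `^ p.
  rewrite [in leRHS](_ : p = 2 * (p / 2)); last by field.
  rewrite [in leRHS]powRrM; apply: ge0_ler_powR; rewrite ?nnegrE ?powR_ge0 ?divr_ge0 ?(ltW p0)//.
  rewrite powR_mulrn//.
  have AZ : A + t * B <= Z by rewrite /Z mulrDl mul1r addrC lerD2l.
  apply: (@le_trans _ _ ((A + t * B) ^+ 2)).
    have : 0 <= t * (A * B - c) by rewrite mulr_ge0 ?(ltW t0)//; lra.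
    nra.
  by rewrite ler_sqr ?nnegrE ?addr_ge0.
have AZ : A `^ p <= Z `^ p.
  apply: ge0_ler_powR; rewrite ?nnegrE ?(ltW p0)//.
  by apply: le_trans AtB _; rewrite /Z mulrDl lerDr mul1r.
rewrite ler_norml; have := powR_ge0 A p.
by have := powR_ge0 (A ^+ 2 + 2 * t * c + t ^+ 2 * B ^+ 2) (p / 2); lra.
Qed.

(* A form of uniform smoothness of the p-th power, [c] being the inner product
   of two vectors of lengths [A] and [B]; for [t * B << A] it is a first order
   expansion of the power at 1, otherwise every term is [O((t * B) `^ p)]. *)
Lemma powR_expand (e : R) : 0 < e -> exists t : R, [/\ 0 < t, t <= 1 &
  forall A B c : R, 0 <= A -> 0 <= B -> `|c| <= A * B ->
  `|(A ^+ 2 + 2 * t * c + t ^+ 2 * B ^+ 2) `^ (p / 2) - A `^ p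
    - p * t * (A `^ (p - 2) * c)| <= e * t * (A `^ p + B `^ p)].
Proof.
move=> e0.
(* Half of [e], divided by the constant 3 of the bound [y3] below. *)
have e6 : 0 < e / 6 by rewrite divr_gt0.
have [d d0 Hd] := powR_taylor1 (p / 2) e6.
(* In the regime [t * B <= k * A]: 1 gives [t * B <= A], [d / 3] puts [y] in the range of the Taylor
   estimate, and [e / p] controls the term quadratic in [t * B]. *)
pose k := Num.min 1 (Num.min (d / 3) (e / p)).
have k0 : 0 < k by rewrite !lt_min ltr01 !divr_gt0.
have k1 : k <= 1 by rewrite ge_min lexx.
have kd : 3 * k <= d.
  have : k <= d / 3 by rewrite !ge_min lexx !orbT.
  lra.
have ke : p / 2 * k <= e / 2.
  have : k <= e / p by rewrite !ge_min lexx !orbT.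
  by rewrite ler_pdivlMr//; lra.
pose C := (1 + k^-1) `^ p + p * k^-1 `^ (p - 1).
have k10 : 0 < k^-1 by rewrite invr_gt0.
have C0 : 0 < C by rewrite ltr_wpDr ?mulr_ge0 ?powR_ge0 ?(ltW p0)// powR_gt0// addr_gt0.
(* Solves C t^(p-1) <= e, which settles the far regime. *)
pose t := Num.min 1 ((e / C) `^ (p - 1)^-1).
have t0 : 0 < t by rewrite lt_min ltr01 powR_gt0// divr_gt0.
have t1 : t <= 1 by rewrite ge_min lexx.
have Ct : C * t `^ (p - 1) <= e.
  rewrite mulrC -ler_pdivlMr//.
  have -> : e / C = ((e / C) `^ (p - 1)^-1) `^ (p - 1).
    by rewrite -powRrM mulVf ?gt_eqF// powRr1// divr_ge0 ?ltW.
  apply: ge0_ler_powR; rewrite ?nnegrE ?powR_ge0 ?(ltW p1) ?(ltW t0)//.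
  by rewrite ge_min lexx orbT.
exists t; split => // A B c A0 B0 cAB.
have [tBA|] := leP (t * B) (k * A); last first.
  move=> /(powR_expand_far A0 B0 cAB t0 k0)/le_trans; apply.
  apply: (@le_trans _ _ (e * (t * B `^ p))).
    by apply: ler_wpM2r => //; rewrite mulr_ge0 ?powR_ge0 ?(ltW t0).
  rewrite mulrDr mulrA lerDr mulr_ge0 ?powR_ge0// mulr_ge0 ?(ltW t0) ?(ltW e0)//.
move: A0; rewrite le_eqVlt => /predU1P[A0|A0].
  move: tBA cAB; rewrite -A0 mulr0 mul0r pmulr_rle0// => B0'.
  have -> : B = 0 by apply/eqP; rewrite eq_le B0 B0'.
  rewrite normr_le0 => /eqP ->.
  rewrite expr0n/= !mulr0 !addr0 !powR0 ?gt_eqF ?divr_gt0//.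
  by rewrite !subr0 addr0 mulr0 normr0.
have An0 : A != 0 by rewrite gt_eqF.
(* The relative increment of the squared length: the base of the power is [A ^+ 2 * (1 + y)]. *)
pose y := (2 * t * c + t ^+ 2 * B ^+ 2) / A ^+ 2.
have tB0 : 0 <= t * B by rewrite mulr_ge0// ltW.
have y3 : `|y| * A <= 3 * (t * B).
  rewrite /y normf_div [X in _ / X]ger0_norm ?exprn_ge0 ?(ltW A0)//.
  rewrite mulrAC ler_pdivrMr ?exprn_gt0//.
  rewrite -subr_ge0.
  rewrite (_ : _ - _ = A * (3 * (t * B) * A - `|2 * t * c + t ^+ 2 * B ^+ 2|)); last by ring.
  rewrite mulr_ge0 ?(ltW A0)// subr_ge0.
  apply: le_trans (ler_normD _ _) _.
  rewrite [X in _ + X]ger0_norm ?mulr_ge0 ?exprn_ge0 ?(ltW t0)//.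
  rewrite normrM ger0_norm ?mulr_ge0 ?(ltW t0)//.
  have h1 : t * `|c| <= t * (A * B) by rewrite ler_wpM2l ?(ltW t0).
  have tBA' : t * B <= A by apply: le_trans tBA _; rewrite -[leRHS]mul1r ler_wpM2r ?(ltW A0).
  have h2 : (t * B) * (t * B) <= (t * B) * A by rewrite ler_wpM2l.
  nra.
have yd : `|y| <= d.
  rewrite -(ler_pM2r A0); apply: le_trans y3 _.
  have : k * A * 3 <= d * A by rewrite mulrAC (mulrC k) ler_wpM2r ?(ltW A0).
  lra.
have Hy := Hd y yd.
have V : A ^+ 2 + 2 * t * c + t ^+ 2 * B ^+ 2 = A ^+ 2 * (1 + y).
  by rewrite /y; field.
have Ap : (A ^+ 2) `^ (p / 2) = A `^ p.
  by rewrite -powR_mulrn ?(ltW A0)// -powRrM; congr (_ `^ _); field.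
have y1 : 0 <= 1 + y.
  rewrite -(pmulr_rge0 _ (exprn_gt0 2 A0)) -V.
  move: cAB; rewrite ler_norml => /andP[c1 c2].
  have : 0 <= (A - t * B) ^+ 2 by exact: sqr_ge0.
  have : 0 <= t * (A * B + c) by rewrite mulr_ge0 ?(ltW t0)//; lra.
  nra.
rewrite V powRM ?exprn_ge0 ?(ltW A0)// Ap.
have P0 : 0 < A `^ (p - 2) by rewrite powR_gt0.
have PA : A `^ p = A `^ (p - 2) * A ^+ 2.
  by rewrite powRB1M ?(ltW A0)// powRB2M ?(ltW A0)// -mulrA -expr2.
have PAB : A `^ (p - 2) * A * B <= A `^ p + B `^ p.
  by rewrite -powRB2M ?(ltW A0)// powR_young1// ltW.
set P := A `^ (p - 2) in P0 PA PAB *.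
(* The linear term [p / 2 * y] contains the wanted first-order term plus a part quadratic in
   [t * B]. That part and the Taylor remainder each receive half of [e]. *)
have E : A `^ p * (1 + y) `^ (p / 2) - A `^ p - p * t * (P * c) =
   A `^ p * ((1 + y) `^ (p / 2) - 1 - p / 2 * y) + p / 2 * P * (t * B) ^+ 2.
  by rewrite PA /y; field.
rewrite E; apply: le_trans (ler_normD _ _) _.
have b1 : `|A `^ p * ((1 + y) `^ (p / 2) - 1 - p / 2 * y)| <= e / 2 * t * (P * A * B).
  rewrite normrM ger0_norm ?powR_ge0//.
  apply: (@le_trans _ _ (A `^ p * (e / 6 * `|y|))).
    by apply: ler_wpM2l => //; exact: powR_ge0.
  rewrite PA (_ : _ * _ = e / 6 * P * A * (`|y| * A)); last by ring.
  rewrite (_ : e / 2 * _ * _ = e / 6 * P * A * (3 * (t * B))); last by field.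
  by apply: ler_wpM2l => //; rewrite !mulr_ge0 ?(ltW A0) ?(ltW P0) ?(ltW e0)//.
have b2 : `|p / 2 * P * (t * B) ^+ 2| <= e / 2 * t * (P * A * B).
  rewrite ger0_norm ?mulr_ge0 ?exprn_ge0 ?(ltW P0) ?(ltW p0) ?(ltW t0)//.
  apply: (@le_trans _ _ (p / 2 * k * (t * (P * A * B)))).
    rewrite (_ : _ * _ ^+ 2 = (p / 2 * P * (t * B)) * (t * B)); last by ring.
    rewrite [leRHS](_ : _ = (p / 2 * P * (t * B)) * (k * A)); last by ring.
    by apply: ler_wpM2l => //; rewrite !mulr_ge0 ?(ltW P0) ?(ltW p0) ?(ltW t0).
  rewrite -[leRHS]mulrA; apply: ler_wpM2r => //.
  by rewrite !mulr_ge0 ?(ltW P0) ?(ltW A0) ?(ltW t0).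
apply: le_trans (lerD b1 b2) _.
rewrite -mulrDl -mulrDl -splitr; apply: ler_wpM2l => //.
by rewrite mulr_ge0 ?(ltW t0) ?(ltW e0).
Qed.

End power_inequalities.

(** * Test functions and cutoffs *)

Section test_functions.
Context (R : realType) (N : nat).
Implicit Types (A B : set 'rV[R]_N) (f g : 'rV[R]_N -> R) (x : 'rV[R]_N).

Lemma fsupport_neq0 f x : f x != 0 -> fsupport f x.
Proof. by move=> fx; apply: subset_closure. Qed.

Lemma notin_fsupport f x : ~ fsupport f x -> f x = 0.
Proof. by move=> fx; apply/eqP/negP => /negP/fsupport_neq0. Qed.

Lemma gradient_notin_fsupport f x : ~ fsupport f x -> gradient f x = 0.
Proof.
move=> fx; apply/rowP => i; rewrite !mxE /partial.
rewrite (@near_eq_derive _ _ _ f (cst 0)) ?derive_cst//.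
have : nbhs x (~` fsupport f).
  by apply: open_nbhs_nbhs; split => //; apply/closed_openC/closed_closure.
by apply: filterS => z /notin_fsupport.
Qed.

Lemma test_fun_eq0 A f x : test_fun A f -> ~ A x -> f x = 0.
Proof. by move=> [_ _ fA] Ax; apply: notin_fsupport => /fA. Qed.

Lemma test_fun_gradient_eq0 A f x : test_fun A f -> ~ A x -> gradient f x = 0.
Proof. by move=> [_ _ fA] Ax; apply: gradient_notin_fsupport => /fA. Qed.

Lemma test_fun_compact A f (K : set 'rV[R]_N) : smooth f -> compact K ->
  K `<=` A -> (forall x, f x != 0 -> K x) -> test_fun A f.
Proof.
move=> sf cK KA fK; have clK : closed K by apply: compact_closed => //; exact: norm_hausdorff.
have sK : fsupport f `<=` K.
  apply: subset_trans (closure_subset (fK : [set x | f x != 0] `<=` K)) _.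
  by rewrite -(iffLR (closure_id K) clK).
split => //; last exact: subset_trans KA.
by apply: (subclosed_compact _ cK sK); exact: closed_closure.
Qed.

Lemma test_funW A B f : A `<=` B -> test_fun A f -> test_fun B f.
Proof. by move=> AB [sf cf fA]; split => //; exact: subset_trans AB. Qed.

Lemma test_funD A f g : test_fun A f -> test_fun A g -> test_fun A (f + g).
Proof.
move=> [sf cf fA] [sg cg gA].
apply: (@test_fun_compact _ _ (fsupport f `|` fsupport g)).
- exact: smoothD.
- exact: compactU.
- by move=> x [/fA|/gA].
- move=> x fgx; have [fx0|fx] := eqVneq (f x) 0; [right|left]; apply: fsupport_neq0 => //.
  by apply: contra_neq fgx => gx0; rewrite !fctE fx0 gx0 addr0.
Qed.

Lemma test_funZ A f (c : R) : test_fun A f -> test_fun A (fun x => c * f x).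
Proof.
move=> [sf cf fA]; apply: (@test_fun_compact _ _ (fsupport f)) => //.
  exact: smoothZ.
by move=> x; rewrite mulf_eq0 negb_or => /andP[_]; exact: fsupport_neq0.
Qed.

Lemma test_fun0 A : test_fun A (fun=> 0).
Proof.
apply: (@test_fun_compact _ _ set0) => //.
- exact: smooth_cst.
- exact: compact0.
- by move=> x; rewrite eqxx.
Qed.

Lemma test_funM A B f g (F : set 'rV[R]_N) : smooth f -> closed F ->
  (forall x, f x != 0 -> F x) -> A `&` F `<=` B -> test_fun A g ->
  test_fun B (f * g).
Proof.
move=> sf clF fF AFB [sg cg gA].
apply: (@test_fun_compact _ _ (fsupport g `&` F)).
- exact: smoothM.
- exact: compact_closedI.
- by move=> x [/gA Ax Fx]; apply: AFB.
- move=> x; rewrite !fctE mulf_eq0 negb_or => /andP[fx gx].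
  by split; [exact: fsupport_neq0|exact: fF].
Qed.

Lemma normr_coord_le (x : 'rV[R]_N) i : `|x 0 i| <= `|x|.
Proof.
rewrite {2}/Num.norm/= mx_normE -[leLHS]nngE num_le.
exact: (@le_bigmax _ _ _ _ (fun ij => `|x ij.1 ij.2|%:nng) (0, i)).
Qed.

Lemma test_fun_vanishes A f : test_fun A f -> exists M, vanishes_outside M f.
Proof.
move=> [_ /compact_bounded[M [_ fM]] _]; exists (`|M| + 1) => x xM.
apply: notin_fsupport => fx; apply: xM => i.
apply: (le_trans (normr_coord_le x i)); apply: fM fx.
by rewrite ltr_pwDr// ler_norm.
Qed.

Lemma integration_by_parts_test A f g i : test_fun A f -> smooth g ->
  (\int[lebesgue_rV R N]_x (f x * partial i g x)%:E =
   - \int[lebesgue_rV R N]_x (partial i f x * g x)%:E)%E.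
Proof.
move=> tf sg; have [M f0] := test_fun_vanishes tf; have [sf _ _] := tf.
have df0 := @vanishes_outside_partial _ _ _ _ i f0.
have pM : partial i (f * g) = (fun x => f x * partial i g x + partial i f x * g x).
  apply/funext => x; have := gradientM x sf sg.
  by move=> /rowP/(_ i); rewrite !mxE (mulrC (g x)).
have i1 : (lebesgue_rV R N).-integrable setT (EFin \o (fun x => f x * partial i g x)).
  apply: (@integrable_cube _ _ M) => [|x /f0 ->]; last by rewrite mul0r.
  by move=> x; apply: continuousM; [exact: smooth_continuous|exact: continuous_partial].
have i2 : (lebesgue_rV R N).-integrable setT (EFin \o (fun x => partial i f x * g x)).
  apply: (@integrable_cube _ _ M) => [|x /df0 ->]; last by rewrite mul0r.
  by move=> x; apply: continuousM; [exact: continuous_partial|exact: smooth_continuous].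
have := @integral_partial_eq0 R N i (f * g) M.
rewrite pM; under eq_integral do rewrite EFinD.
rewrite integralD//= => H.
have {H} : (\int[lebesgue_rV R N]_x (f x * partial i g x)%:E +
    \int[lebesgue_rV R N]_x (partial i f x * g x)%:E = 0)%E.
  apply: H.
  - exact/smooth_continuous/smoothM.
  - by rewrite -pM; apply/continuous_partial/smoothM.
  - by move=> x; have := smooth_is_derive i x (smoothM sf sg); case.
  - by move=> x /f0 fx; rewrite !fctE fx mul0r.
move: (integrable_fin_num measurableT i1) (integrable_fin_num measurableT i2).
rewrite /=; case: (integral _ _ _) => // a _; case: (integral _ _ _) => // b _.
by move=> [/eqP]; rewrite addr_eq0 => /eqP ->.
Qed.

End test_functions.

(** * A smooth radial cutoff with gradient bounded uniformly in the radius *)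

Section cutoff.
Context (R : realType) (N : nat).
Implicit Types (x : 'rV[R]_N) (r : R).

Lemma flat0_le (x y : R) : x <= y -> flat 0 x <= flat 0 y.
Proof.
move=> xy; have [x0|x0] := leP x 0; first by rewrite flat_le0// flat_ge0.
have y0 := lt_le_trans x0 xy.
by rewrite /flat x0 y0 !expr0 !mul1r ler_expR lerN2 lef_pV2.
Qed.

Let c : R := (flat 0 1)^-1.

Let c0 : 0 < c. Proof. by rewrite invr_gt0 flat_gt0. Qed.

Let cle (x : R) : x <= 1 -> c * flat 0 x <= 1.
Proof. by move=> x1; rewrite mulrC ler_pdivrMr ?flat_gt0// mul1r flat0_le. Qed.

Let cge (x : R) : 1 <= x -> 1 <= c * flat 0 x.
Proof. by move=> x1; rewrite mulrC ler_pdivlMr ?flat_gt0// mul1r flat0_le. Qed.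

(* Composing [flat 0] with itself yields a smooth step without any quotient. *)
Definition cutoff_arg r x : R := r ^- 2 * dotp x x + (- 2).

Definition cutoff r x : R :=
  1 + (- c) * flat 0 (1 + (- c) * flat 0 (cutoff_arg r x)).

Lemma smooth_cutoff r : smooth (cutoff r).
Proof.
have sd : smooth_gen (fun x : 'rV[R]_N => dotp x x).
  rewrite /dotp; elim: (index_enum _) => [|i s IH].
    rewrite (_ : (fun x => _) = fun=> 0); first exact: smooth_gen_cst.
    by apply/funext => y; rewrite big_nil.
  rewrite (_ : (fun x => _) = (fun x => x 0 i) * (fun x => x 0 i)
                              + (fun x => \sum_(i <- s) x 0 i * x 0 i)).
    by apply: smooth_genD => //; apply: smooth_genM; exact: smooth_gen_coord.
  by apply/funext => y; rewrite big_cons.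
apply: smooth_genW.
have sa : smooth_gen (cutoff_arg r).
  rewrite (_ : cutoff_arg r = (fun=> r ^- 2) * (fun x => dotp x x) + (fun=> - 2))//.
  by apply: smooth_genD; [apply: smooth_genM => //|]; exact: smooth_gen_cst.
have h f : smooth_gen f -> smooth_gen (fun x : 'rV[R]_N => 1 + (- c) * flat 0 (f x)).
  move=> sf; rewrite (_ : (fun x => _) = (fun=> 1) + (fun=> - c) * (flat 0 \o f))//.
  apply: smooth_genD; first exact: smooth_gen_cst.
  by apply: smooth_genM; [exact: smooth_gen_cst|exact: smooth_gen_flat].
exact/h/h.
Qed.

Lemma cutoff_ge0 r x : 0 <= cutoff r x.
Proof.
rewrite /cutoff mulNr subr_ge0; apply: cle.
by rewrite mulNr gerDl oppr_le0 mulr_ge0 ?flat_ge0// ltW.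
Qed.

Lemma cutoff_le1 r x : cutoff r x <= 1.
Proof. by rewrite /cutoff mulNr gerDl oppr_le0 mulr_ge0 ?flat_ge0// ltW. Qed.

(** A nonpositive argument makes the inner step equal to 1, where the normalisation by [c] makes the
    outer step 0. The thresholds 2 r^2 and 3 r^2 lie strictly between the squares of the radii r and
    2 r. *)
Lemma cutoff_eq0 r x : 0 < r -> dotp x x <= 2 * r ^+ 2 -> cutoff r x = 0.
Proof.
move=> r0 xr; rewrite /cutoff (@flat_le0 _ _ (cutoff_arg r x)); last first.
  by rewrite /cutoff_arg subr_le0 mulrC ler_pdivrMr ?exprn_gt0.
by rewrite mulr0 addr0 mulNr /c mulVf ?subrr// gt_eqF// flat_gt0.
Qed.

(** Once [cutoff_arg] reaches 1, the inner step is nonpositive and every [flat k] vanishes there: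
    [k = 0] yields the value 1 of the cutoff, [k = 2] its zero gradient. *)
Let flat_cutoff_eq0 k r x : 0 < r -> 3 * r ^+ 2 <= dotp x x ->
  flat k (1 + (- c) * flat 0 (cutoff_arg r x)) = 0.
Proof.
move=> r0 xr; apply: flat_le0; rewrite mulNr subr_le0; apply: cge.
by rewrite /cutoff_arg lerBrDr mulrC ler_pdivlMr ?exprn_gt0.
Qed.

Lemma cutoff_eq1 r x : 0 < r -> 3 * r ^+ 2 <= dotp x x -> cutoff r x = 1.
Proof. by move=> r0 xr; rewrite /cutoff flat_cutoff_eq0// mulr0 addr0. Qed.

Lemma is_derive_dotp i x :
  is_derive x (delta_mx 0 i : 'rV[R]_N) (fun x : 'rV[R]_N => dotp x x) (2 * x 0 i).
Proof.
have de (z : 'rV[R]_N) : dotp (delta_mx 0 i) z = z 0 i.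
  rewrite /dotp (bigD1 i)//= mxE !eqxx mul1r big1 ?addr0// => j ji.
  by rewrite mxE (negbTE ji) andbF mul0r.
apply/is_derive1P.
have -> : (fun h : R => dotp (h *: delta_mx 0 i + x) (h *: delta_mx 0 i + x)) =
  (id : R -> R) * (id + cst (2 * x 0 i)) + cst (dotp x x).
  apply/funext => h; rewrite !fctE dotpDl !dotpDr !dotpZl !dotpZr (dotpC x) !de.
  by rewrite !mxE !eqxx/=; ring.
have := is_deriveD (is_deriveM (is_derive_id (0 : R) (1 : R))
  (is_deriveD (is_derive_id (0 : R) (1 : R)) (is_derive_cst (2 * x 0 i) (0 : R) (1 : R))))
  (is_derive_cst (dotp x x) (0 : R) (1 : R)).
case=> d1 d2; apply: DeriveDef => //.
by rewrite [LHS]d2 /GRing.scale/= !fctE; ring.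
Qed.

Lemma gradient_cutoff r x : gradient (cutoff r) x =
  (c ^+ 2 * flat 2 (1 + (- c) * flat 0 (cutoff_arg r x)) *
   flat 2 (cutoff_arg r x) * r ^- 2 * 2) *: x.
Proof.
apply/rowP => i; rewrite !mxE.
have h (f : 'rV[R]_N -> R) d : is_derive x (delta_mx 0 i : 'rV[R]_N) f d ->
    is_derive x (delta_mx 0 i : 'rV[R]_N) (fun x => 1 + (- c) * flat 0 (f x))
      (- c * (flat 2 (f x) * d)).
  move=> df.
  have dfl : is_derive x (delta_mx 0 i : 'rV[R]_N) (flat 0 \o f) (flat 2 (f x) * d).
    apply: is_derive_comp1 => //.
    by have := is_derive_flat 0 (f x); rewrite mul0r subr0.
  have := is_deriveD (is_derive_cst (1 : R) x (delta_mx 0 i : 'rV[R]_N))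
    (is_deriveM (is_derive_cst (- c) x (delta_mx 0 i : 'rV[R]_N)) dfl).
  case=> d1 d2; apply: DeriveDef => //.
  by rewrite [LHS]d2 /GRing.scale/= !mulr0 addr0 add0r.
have da : is_derive x (delta_mx 0 i : 'rV[R]_N) (cutoff_arg r) (r ^- 2 * (2 * x 0 i)).
  have := is_deriveD (is_deriveM (is_derive_cst (r ^- 2) x (delta_mx 0 i : 'rV[R]_N))
    (is_derive_dotp i x)) (is_derive_cst (- 2 : R) x (delta_mx 0 i : 'rV[R]_N)).
  case=> d1 d2; apply: DeriveDef => //.
  by rewrite [LHS]d2 /GRing.scale/= !mulr0 !addr0.
have [_] := h _ _ (h _ _ da); rewrite /partial => ->; ring.
Qed.

Lemma gradient_cutoff_eq0 r x : 0 < r -> 3 * r ^+ 2 <= dotp x x ->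
  gradient (cutoff r) x = 0.
Proof.
by move=> r0 xr; rewrite gradient_cutoff flat_cutoff_eq0// mulr0 !mul0r scale0r.
Qed.

(** [64 * c ^+ 2] is 2 c^2 times 4 * 4 for the two factors [flat 2], times 2 for |x| / r^2, which is
    at most 2 / r wherever the gradient is nonzero. *)
Definition cutoff_bound : R := 64 * c ^+ 2.

Lemma cutoff_bound_ge0 : 0 <= cutoff_bound.
Proof. by rewrite mulr_ge0// exprn_ge0// ltW. Qed.

Lemma enorm_gradient_cutoff r x : 1 <= r ->
  enorm (gradient (cutoff r) x) <= cutoff_bound.
Proof.
move=> r1; have r0 : 0 < r by exact: lt_le_trans r1.
have [xr|xr] := leP (3 * r ^+ 2) (dotp x x).
  by rewrite gradient_cutoff_eq0// enorm0 cutoff_bound_ge0.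
have x2r : enorm x <= 2 * r.
  rewrite -ler_sqr ?nnegrE ?enorm_ge0 ?mulr_ge0 ?(ltW r0)// sqr_enorm.
  by apply: le_trans (ltW xr) _; rewrite exprMn ler_wpM2r ?exprn_ge0 ?(ltW r0)// -natrX ler_nat.
rewrite gradient_cutoff enormZ ger0_norm; last first.
  by rewrite !mulr_ge0// ?flat_ge0 ?invr_ge0 ?exprn_ge0 ?(ltW c0) ?(ltW r0) ?flat_ge0.
set a := flat 2 _; set b := flat 2 _.
have a4 : a <= 4 by apply: le_trans (flat_le _ _) _; rewrite -natrX.
have b4 : b <= 4 by apply: le_trans (flat_le _ _) _; rewrite -natrX.
have ab : a * b <= 4 * 4 by rewrite ler_pM ?flat_ge0.
have rx : r ^- 2 * enorm x <= 2.
  rewrite mulrC ler_pdivrMr ?exprn_gt0//; apply: le_trans x2r _.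
  by rewrite ler_pM2l// expr2 ler_peMl ?(ltW r0).
have -> : c ^+ 2 * a * b * r ^- 2 * 2 * enorm x = 2 * c ^+ 2 * ((a * b) * (r ^- 2 * enorm x)).
  by ring.
have -> : cutoff_bound = 2 * c ^+ 2 * ((4 * 4) * 2) by rewrite /cutoff_bound; ring.
apply: ler_wpM2l; first by rewrite mulr_ge0// exprn_ge0// ltW.
by rewrite ler_pM ?mulr_ge0 ?flat_ge0 ?invr_ge0 ?exprn_ge0 ?enorm_ge0 ?(ltW r0).
Qed.

End cutoff.

(** * Integrals of p-th powers *)

Section Lp_powers.
Context d (T : measurableType d) (R : realType).
Variables (mu : {measure set T -> \bar R}) (D : set T) (p : R).
Hypotheses (mD : measurable D) (p_gt1 : 1 < p).
Implicit Types (A B C c h : T -> R).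

Let p0 : 0 < p. Proof. exact: lt_trans p_gt1. Qed.

Lemma integrable_EFinZ (k : R) h : mu.-integrable D (EFin \o h) ->
  mu.-integrable D (EFin \o (fun x => k * h x)).
Proof. exact: integrableZl. Qed.

Lemma integrable_EFinD A B : mu.-integrable D (EFin \o A) ->
  mu.-integrable D (EFin \o B) -> mu.-integrable D (EFin \o (fun x => A x + B x)).
Proof. exact: integrableD. Qed.

Lemma integrable_EFinB A B : mu.-integrable D (EFin \o A) ->
  mu.-integrable D (EFin \o B) -> mu.-integrable D (EFin \o (fun x => A x - B x)).
Proof. exact: integrableB. Qed.

Definition Lp_fun h := [/\ forall x, 0 <= h x, measurable_fun D h &
  mu.-integrable D (EFin \o (fun x => h x `^ p))].

Definition Lp_power h : R := \int[mu]_(x in D) (h x `^ p).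

Lemma Lp_power_ge0 h : 0 <= Lp_power h.
Proof. by apply: Rintegral_ge0 => x _; exact: powR_ge0. Qed.

Lemma integral_Lp_fun h : Lp_fun h ->
  (\int[mu]_(x in D) (h x `^ p)%:E = (Lp_power h)%:E)%E.
Proof. by move=> [_ _ ih]; rewrite /Lp_power fineK//; exact: integrable_fin_num ih. Qed.

Lemma measurable_Lp_power h : measurable_fun D h ->
  measurable_fun D (fun x => h x `^ p).
Proof. exact: measurableT_comp (measurable_powR p). Qed.

Lemma Lp_fun_lty h : (forall x, 0 <= h x) -> measurable_fun D h ->
  (\int[mu]_(x in D) (h x `^ p)%:E < +oo)%E -> Lp_fun h.
Proof.
move=> h0 mh hoo; split => //; apply/integrableP; split.
  by apply/measurable_EFinP; exact: measurable_Lp_power.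
by under eq_integral => x _ do rewrite /= ger0_norm ?powR_ge0//.
Qed.

Lemma Lp_fun_le A C : (forall x, 0 <= C x) -> measurable_fun D C ->
  (forall x, D x -> C x <= A x) -> Lp_fun A -> Lp_fun C.
Proof.
move=> C0 mC CA [A0 mA iA]; split => //.
apply: le_integrable iA => //; first by apply/measurable_EFinP; exact: measurable_Lp_power.
move=> x Dx /=; rewrite lee_fin !ger0_norm ?powR_ge0//.
by apply: ge0_ler_powR; rewrite ?nnegrE ?(ltW p0)//; exact: CA.
Qed.

Lemma Lp_power_le A C : (forall x, 0 <= C x) -> measurable_fun D C ->
  (forall x, D x -> C x <= A x) -> Lp_fun A -> Lp_power C <= Lp_power A.
Proof.
move=> C0 mC CA iA; have [_ _ iC] := Lp_fun_le C0 mC CA iA.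
have [A0 _ {}iA] := iA; apply: le_Rintegral => // x Dx.
by apply: ge0_ler_powR; rewrite ?nnegrE ?(ltW p0)//; exact: CA.
Qed.

Lemma Lp_funZ A (a : R) : 0 <= a -> Lp_fun A -> Lp_fun (fun x => a * A x).
Proof.
move=> a0 [A0 mA iA]; split => [x||]; first by rewrite mulr_ge0.
  exact: measurable_funM.
rewrite (_ : (fun x => _) = fun x => a `^ p * A x `^ p); first exact: integrable_EFinZ.
by apply/funext => x /=; rewrite powRM.
Qed.

Lemma Lp_powerZ A (a : R) : 0 <= a -> Lp_fun A ->
  Lp_power (fun x => a * A x) = a `^ p * Lp_power A.
Proof.
move=> a0 [A0 mA iA]; rewrite /Lp_power -RintegralZl//.
by apply: eq_Rintegral => x _; rewrite powRM.
Qed.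

Lemma Lp_funD_subproof A B (k : R) : Lp_fun A -> Lp_fun B ->
  mu.-integrable D (EFin \o (fun x => (1 + k) `^ p * A x `^ p + (1 + k^-1) `^ p * B x `^ p)).
Proof.
move=> [A0 mA iA] [B0 mB iB].
by apply: integrable_EFinD => //; exact: integrable_EFinZ.
Qed.

Lemma Lp_fun_leD A B C : (forall x, 0 <= C x) -> measurable_fun D C ->
  (forall x, D x -> C x <= A x + B x) -> Lp_fun A -> Lp_fun B -> Lp_fun C.
Proof.
move=> C0 mC CAB iA iB; split => //.
apply: le_integrable (Lp_funD_subproof 1 iA iB) => //.
  by apply/measurable_EFinP; exact: measurable_Lp_power.
move: iA iB => [A0 _ _] [B0 _ _] x Dx /=.
rewrite lee_fin !ger0_norm ?powR_ge0// ?addr_ge0 ?mulr_ge0 ?powR_ge0//.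
apply: le_trans (powR_addr_le p_gt1 _ _ _) => //.
by apply: ge0_ler_powR; rewrite ?nnegrE ?addr_ge0 ?(ltW p0)//; exact: CAB.
Qed.

(** Plays the part of Minkowski's inequality: the constant of the main term [A] can be brought close
    to 1, at the price of a large one on the error [B]. *)
Lemma Lp_power_leD A B C (k : R) : (forall x, 0 <= C x) -> measurable_fun D C ->
  (forall x, D x -> C x <= A x + B x) -> Lp_fun A -> Lp_fun B -> 0 < k ->
  Lp_power C <= (1 + k) `^ p * Lp_power A + (1 + k^-1) `^ p * Lp_power B.
Proof.
move=> C0 mC CAB iA iB k0.
have [_ _ iC] := Lp_fun_leD C0 mC CAB iA iB.
have iAB := Lp_funD_subproof k iA iB.
move: iA iB => [A0 _ iA] [B0 _ iB].
rewrite /Lp_power -!RintegralZl// -RintegralD//; last 2 first.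
- exact: integrable_EFinZ.
- exact: integrable_EFinZ.

apply: le_Rintegral => // x Dx.
apply: le_trans (powR_addr_le p_gt1 _ _ _) => //.
by apply: ge0_ler_powR; rewrite ?nnegrE ?addr_ge0 ?(ltW p0)//; exact: CAB.
Qed.

Lemma Lp_fun_patch A (E : set T) : measurable E -> Lp_fun A -> Lp_fun (A \_ E).
Proof.
move=> mE iA; have [A0 mA _] := iA.
have AE0 x : 0 <= (A \_ E) x by rewrite /patch; case: ifP.
apply: Lp_fun_le iA => //.
  by rewrite /patch -measurable_restrict//; apply: measurable_funS mA.
by move=> x Dx; rewrite /patch; case: ifP.
Qed.

(** Lets the mass on [E] enter the inequalities stated on the whole of [D], by extending by 0. *)
Lemma Lp_power_patch A (E : set T) :
  Lp_power (A \_ E) = \int[mu]_(x in D `&` E) (A x `^ p).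
Proof.
rewrite Rintegral_mkcondr; apply: eq_Rintegral => x _.
by rewrite /patch; case: ifP => // _; rewrite powR0// gt_eqF.
Qed.

Lemma Lp_power_patch_le A (E : set T) : measurable E -> Lp_fun A ->
  Lp_power (A \_ E) <= Lp_power A.
Proof.
move=> mE iA; have [AE0 mAE _] := Lp_fun_patch mE iA; have [A0 _ _] := iA.
by apply: Lp_power_le => // x _; rewrite /patch; case: ifP => // _; exact: A0.
Qed.

Section pairing.
Variables (A B c : T -> R).
Hypotheses (iA : Lp_fun A) (iB : Lp_fun B) (mc : measurable_fun D c).
Hypothesis cAB : forall x, `|c x| <= A x * B x.

(** One formula for both functionals: [A] is |v| and [c] is v f for the power functional, [A] is
    |grad v| and [c] the inner product of the gradients for the p-Laplacian. *)
Definition pairing : R := \int[mu]_(x in D) (A x `^ (p - 2) * c x).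

Lemma integrable_pairing :
  mu.-integrable D (EFin \o (fun x => A x `^ (p - 2) * c x)).
Proof.
have [A0 mA iA'] := iA; have [B0 mB iB'] := iB.
apply: (le_integrable _ _ _ (integrable_EFinD iA' iB')) => //.
  apply/measurable_EFinP; apply: measurable_funM => //.
  exact: measurableT_comp (measurable_powR _) mA.
move=> x Dx /=; rewrite lee_fin [leRHS]ger0_norm ?addr_ge0 ?powR_ge0//.
by apply: le_trans (powRB2_abs_le p_gt1 (A0 x) (cAB x)) (powR_young1 p_gt1 _ _).
Qed.

Lemma pairing_le k : 0 < k ->
  `|pairing| <= k * Lp_power A + (k^-1) `^ (p - 1) * Lp_power B.
Proof.
move=> k0; have ip := integrable_pairing.
have [A0 mA iA'] := iA; have [B0 mB iB'] := iB.
apply: le_trans (le_normr_Rintegral _ _) _ => //.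
rewrite /Lp_power -!RintegralZl// -RintegralD//; last 2 first.
- exact: integrable_EFinZ.
- exact: integrable_EFinZ.

apply: le_Rintegral => //.
- exact: integrable_norm.
- by apply: integrable_EFinD => //; exact: integrable_EFinZ.
- move=> x Dx; apply: le_trans (powRB2_abs_le p_gt1 (A0 x) (cAB x)) _.
  exact: powR_young.
Qed.

Lemma pairing_expand (e t : R) (C : T -> R) :
  (forall x, 0 <= C x) -> measurable_fun D C ->
  (forall x, `|C x `^ p - A x `^ p - p * t * (A x `^ (p - 2) * c x)|
     <= e * t * (A x `^ p + B x `^ p)) ->
  Lp_fun C ->
  `|Lp_power C - Lp_power A - p * t * pairing| <= e * t * (Lp_power A + Lp_power B).
Proof.
move=> C0 mC Hx iC; have ip := integrable_pairing.
have [_ mA iA'] := iA; have [_ mB iB'] := iB; have [_ _ iC'] := iC.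
have i1 : mu.-integrable D (EFin \o (fun x => C x `^ p - A x `^ p)).
  exact: integrable_EFinB.
have i2 : mu.-integrable D (EFin \o (fun x => p * t * (A x `^ (p - 2) * c x))).
  exact: integrable_EFinZ.
have i3 : mu.-integrable D (EFin \o (fun x => A x `^ p + B x `^ p)).
  exact: integrable_EFinD.
rewrite /Lp_power /pairing -RintegralB// -RintegralZl// -RintegralB// -RintegralD// -RintegralZl//.
apply: le_trans (le_normr_Rintegral _ _) _ => //; first exact: integrable_EFinB.
apply: le_Rintegral => //.
- by apply: integrable_norm; exact: integrable_EFinB.
- exact: integrable_EFinZ.
Qed.

End pairing.

Lemma pairingZ A c (a : R) :
  mu.-integrable D (EFin \o (fun x => A x `^ (p - 2) * c x)) ->
  pairing A (fun x => a * c x) = a * pairing A c.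
Proof.
move=> ic; rewrite /pairing -RintegralZl//.
by apply: eq_Rintegral => x _; rewrite mulrCA.
Qed.

Lemma pairingB A c1 c2 :
  mu.-integrable D (EFin \o (fun x => A x `^ (p - 2) * c1 x)) ->
  mu.-integrable D (EFin \o (fun x => A x `^ (p - 2) * c2 x)) ->
  pairing A (fun x => c1 x - c2 x) = pairing A c1 - pairing A c2.
Proof.
move=> i1 i2; rewrite /pairing -RintegralB//.
by apply: eq_Rintegral => x _; rewrite mulrBr.
Qed.

End Lp_powers.

Lemma Lp_power_restrict d (T : measurableType d) (R : realType) (p : R) (p_gt1 : 1 < p)
    (mu : {measure set T -> \bar R}) (A B : set T) (h : T -> R) : A `<=` B ->
  (forall x, ~ A x -> h x = 0) -> Lp_power mu A p h = Lp_power mu B p h.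
Proof.
move=> AB h0; rewrite /Lp_power Rintegral_mkcond [RHS]Rintegral_mkcond.
apply: eq_Rintegral => x _; rewrite /patch.
case: ifPn => [|/negP xA].
  by rewrite inE => /AB Bx; rewrite mem_set.
case: ifP => // _; rewrite h0; last by move=> Ax; apply: xA; rewrite inE.
by rewrite powR0// gt_eqF// (lt_trans _ p_gt1).
Qed.

(** * Norms of test functions, and the effect of the cutoff on them *)

Section euclidean_Lp.
Local Opaque Lp_power.
Context (R : realType) (N : nat) (p : R).
Hypothesis p_gt1 : 1 < p.
Implicit Types (A B Omega : set 'rV[R]_N) (f g : 'rV[R]_N -> R) (x : 'rV[R]_N).

Notation mu := (lebesgue_rV R N).

Let p0 : 0 < p. Proof. exact: lt_trans p_gt1. Qed.

Lemma int_funE A f : measurable A -> Lp_fun mu A p (fun x => `|f x|) ->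
  int_fun p A f = (Lp_power mu A p (fun x => `|f x|))%:E.
Proof. by move=> mA; apply: integral_Lp_fun. Qed.

Lemma int_vecE A (F : 'rV[R]_N -> 'rV[R]_N) : measurable A ->
  Lp_fun mu A p (fun x => enorm (F x)) ->
  int_vec p A F = (Lp_power mu A p (fun x => enorm (F x)))%:E.
Proof. by move=> mA; apply: integral_Lp_fun. Qed.

Lemma Lp_fun_cube A (h : 'rV[R]_N -> R) (M : R) : measurable A ->
  (forall x, 0 <= h x) -> continuous h -> vanishes_outside M h -> Lp_fun mu A p h.
Proof.
move=> mA h0 ch hM; have mh := continuous_measurable_rV ch.
split => //; first exact: measurable_funTS.
have [K hK] := continuous_cube_bounded ch hM.
apply: (integrableS measurableT) => //.
apply: (@bounded_integrable_cube _ _ M (K `^ p)).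
- exact: measurable_Lp_power.
- move=> x; rewrite ger0_norm ?powR_ge0//.
  have := hK x; rewrite ger0_norm// => hxK.
  by apply: ge0_ler_powR; rewrite ?nnegrE ?(ltW p0)//; exact: le_trans hxK.
- by move=> x /hM ->; rewrite powR0// gt_eqF.
Qed.

Lemma test_fun_Lp A B f : measurable B -> test_fun A f ->
  Lp_fun mu B p (fun x => `|f x|).
Proof.
move=> mB tf; have [M fM] := test_fun_vanishes tf; have [sf _ _] := tf.
apply: (@Lp_fun_cube _ _ M) => // [x|x /fM ->]; last by rewrite normr0.
by apply: continuous_comp; [exact: smooth_continuous|exact: norm_continuous].
Qed.

Lemma test_fun_gradient_Lp A B f : measurable B -> test_fun A f ->
  Lp_fun mu B p (fun x => enorm (gradient f x)).
Proof.
move=> mB tf; have [M fM] := test_fun_vanishes tf; have [sf _ _] := tf.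
apply: (@Lp_fun_cube _ _ M) => // [x||x xM].
- exact: enorm_ge0.
- apply: continuous_enorm => i; under eq_fun do rewrite mxE.
  exact: continuous_partial.
- rewrite (_ : gradient f x = 0) ?enorm0//; apply/rowP => i; rewrite !mxE.
  exact: (@vanishes_outside_partial _ _ _ _ i fM).
Qed.

(** Normalise [g] by G^(-1/p); if G = 0 the claim is just the nonnegativity of the energy. Integrals
    are taken over [B] so that competitors for different radii are compared on the same domain. *)
Lemma lambda_p_le A B g (l : R) : measurable A -> measurable B -> A `<=` B ->
  (l%:E <= lambda_p p A)%E -> test_fun A g ->
  l * Lp_power mu B p (fun x => `|g x|) <= Lp_power mu B p (fun x => enorm (gradient g x)).
Proof.
move=> mA mB AB lA tg; have [sg _ _] := tg.
have g0 x : ~ A x -> `|g x| = 0 by move=> /(test_fun_eq0 tg) ->; rewrite normr0.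
have dg0 x : ~ A x -> enorm (gradient g x) = 0.
  by move=> /(test_fun_gradient_eq0 tg) ->; rewrite enorm0.
rewrite -(Lp_power_restrict p_gt1 mu AB g0) -(Lp_power_restrict p_gt1 mu AB dg0).
set G := Lp_power _ _ _ _; set F := Lp_power _ _ _ _.
have G0 : 0 <= G by exact: Lp_power_ge0.
have F0 : 0 <= F by exact: Lp_power_ge0.
move: G0; rewrite le_eqVlt => /predU1P[<-|G0]; first by rewrite mulr0.
pose c := G `^ (- p^-1).
have c0 : 0 <= c by exact: powR_ge0.
have cp : c `^ p = G^-1.
  exact: (powR_oppV_power p_gt1).
have tw := test_funZ c tg.
have Lg := test_fun_Lp mA tg; have Ldg := test_fun_gradient_Lp mA tg.
have Gw : int_fun p A (fun x => c * g x) = 1%E.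
  rewrite (int_funE mA (test_fun_Lp mA tw)).
  rewrite (_ : (fun x => `|c * g x|) = fun x => c * `|g x|); last first.
    by apply/funext => x; rewrite normrM ger0_norm.
  by rewrite (Lp_powerZ mA c0 Lg) cp mulVf ?(gt_eqF G0).
have : (lambda_p p A <= int_vec p A (gradient (fun x => (c * g x)%R)))%E.
  by apply: ereal_inf_lbound; exists (fun x => c * g x).
move=> /(le_trans lA); rewrite (int_vecE mA (test_fun_gradient_Lp mA tw)).
rewrite (_ : (fun x => enorm _) = fun x => c * enorm (gradient g x)); last first.
  by apply/funext => x; rewrite gradientZ// enormZ ger0_norm.
rewrite (Lp_powerZ mA c0 Ldg) cp lee_fin -/F => lF.
by rewrite -ler_pdivlMr// mulrC.
Qed.

Lemma closure_eball_le (r : R) x : closure (eball r) x -> enorm x <= r.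
Proof.
have cl : closed [set y : 'rV[R]_N | enorm y <= r].
  apply: (@closed_comp _ _ (@enorm R N) [set z | z <= r]); last exact: closed_le.
  by move=> z _; apply: continuous_enorm => i; exact: coord_continuous.
move=> xr; have : closure [set y : 'rV[R]_N | enorm y <= r] x.
  by apply: closure_subset xr => y /ltW.
by rewrite -(iffLR (closure_id _) cl).
Qed.

Lemma open_setD_ball Omega (r : R) : open Omega -> open (Omega `\` closure (eball r)).
Proof.
by move=> oO; apply: openI => //; apply/closed_openC/closed_closure.
Qed.

Lemma test_fun_cutoff Omega f (r : R) : 0 < r -> test_fun Omega f ->
  test_fun (Omega `\` closure (eball r)) (cutoff r * f).
Proof.
move=> r0 tf.
apply: (@test_funM _ _ Omega _ _ _ [set x | 2 * r ^+ 2 <= dotp x x]) => //.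
- exact: smooth_cutoff.
- apply: (@closed_comp _ _ (fun x : 'rV[R]_N => dotp x x) [set z | 2 * r ^+ 2 <= z]);
    last exact: closed_ge.
  by move=> z _; apply: continuous_dotp => i; exact: coord_continuous.
- by move=> x; apply: contraNP => /negP; rewrite -ltNge => /ltW/(cutoff_eq0 r0)->.
- move=> x [Ox /= xr]; split => // /closure_eball_le xr'.
  have : enorm x ^+ 2 <= r ^+ 2 by rewrite ler_sqr// nnegrE ?enorm_ge0// ltW.
  have : 0 < r ^+ 2 by rewrite exprn_gt0.
  by rewrite sqr_enorm; lra.
Qed.

Lemma dotp_ge_eball (r : R) x : 0 < r -> ~ eball (2 * r) x -> 3 * r ^+ 2 <= dotp x x.
Proof.
move=> r0 /negP; rewrite -leNgt => xr.
have : (2 * r) ^+ 2 <= enorm x ^+ 2.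
  by rewrite ler_sqr// nnegrE ?enorm_ge0// mulr_ge0// ltW.
have : 0 < r ^+ 2 by rewrite exprn_gt0.
by rewrite sqr_enorm exprMn (_ : 2 ^+ 2 = 4 :> R); [lra|rewrite -natrX].
Qed.

(** The gradient of the cutoff vanishes outside the ball of radius [2 * r], so the error only sees
    [f] inside it, where a singular sequence loses its mass. *)
Lemma cutoff_gradient_le (f : 'rV[R]_N -> R) (r : R) x : smooth f -> 1 <= r ->
  enorm (gradient (cutoff r * f) x) <=
  enorm (gradient f x) + cutoff_bound R * ((fun x => `|f x|) \_ (eball (2 * r))) x.
Proof.
move=> sf r1; have r0 : 0 < r by exact: lt_le_trans r1.
rewrite (gradientM _ (smooth_cutoff r) sf).
apply: le_trans (enormD _ _) _; apply: lerD.
  rewrite enormZ ger0_norm ?cutoff_ge0// -[leRHS]mul1r ler_wpM2r ?enorm_ge0//.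
  exact: cutoff_le1.
rewrite enormZ /patch; case: ifPn => [_|].
  by rewrite mulrC ler_wpM2r// enorm_gradient_cutoff.
rewrite notin_setE => /(dotp_ge_eball r0) xr.
by rewrite gradient_cutoff_eq0// enorm0 !mulr0.
Qed.

Lemma normr_cutoff_le (f : 'rV[R]_N -> R) (r : R) x : `|(cutoff r * f) x| <= `|f x|.
Proof.
by rewrite !fctE normrM ger0_norm ?cutoff_ge0// ler_piMl// cutoff_le1.
Qed.

Lemma measurable_eball (r : R) : measurable (eball r : set 'rV[R]_N).
Proof.
apply: open_measurable_rV.
apply: (@open_comp _ _ (@enorm R N) [set z | z < r]); last exact: open_lt.
by move=> z _; apply: continuous_enorm => i; exact: coord_continuous.
Qed.

End euclidean_Lp.

(** * Levels of singular Palais-Smale sequences *)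

(** The sum of the coefficients of [e] and [b] arising in [cutoff_sum_le], used as a common bound
    for both. *)
Definition cutoff_error (R : realFieldType) (P Q C l : R) : R :=
  P ^+ 3 * Q + P ^+ 2 * Q * C * (P + Q) + l * P * Q * (P + Q) + l * Q.

Lemma cutoff_error_ge0 (R : realFieldType) (P Q C l : R) :
  0 <= P -> 0 <= Q -> 0 <= C -> 0 <= l -> 0 <= cutoff_error P Q C l.
Proof.
by move=> P0 Q0 C0 l0; rewrite !addr_ge0// !mulr_ge0// ?exprn_ge0// addr_ge0.
Qed.

(** [F] stands for energies, [G] for masses, [b] and [bf] for the masses of u and f in the ball.
    Each of four comparisons costs a factor [P]: grad g with grad f, grad f with grad u, u with f,
    and f with g. *)
Lemma cutoff_sum_le (R : realFieldType) (P Q C l e b bf Fu Fg Gf Gg : R) :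
  0 <= l -> 0 <= P -> 0 <= Q -> 0 <= C -> 0 <= e -> 0 <= b ->
  Fg <= P * (P * Fu + Q * e) + Q * (C * bf) -> 1 <= P * Gf + Q * e ->
  Gf <= P * Gg + Q * bf -> l * Gg <= Fg -> bf <= P * b + Q * e ->
  l <= P ^+ 4 * Fu + cutoff_error P Q C l * (e + b).
Proof.
move=> l0 P0 Q0 C0 e0 b0 hFg h1 hf hlg hbf.
have s1 : l <= l * P * Gf + l * Q * e.
  by have := ler_wpM2l l0 h1; rewrite mulr1 mulrDr !mulrA.
have s2 : l * P * Gf <= P ^+ 2 * (l * Gg) + l * P * Q * bf.
  have := ler_wpM2l (mulr_ge0 l0 P0) hf.
  by rewrite (_ : l * P * (P * Gg + Q * bf) = P ^+ 2 * (l * Gg) + l * P * Q * bf)//; ring.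
have s3 : P ^+ 2 * (l * Gg) <= P ^+ 2 * (P * (P * Fu + Q * e) + Q * (C * bf)).
  by apply: ler_wpM2l; [exact: exprn_ge0|exact: le_trans hFg].
have s4 : (P ^+ 2 * Q * C + l * P * Q) * bf <= (P ^+ 2 * Q * C + l * P * Q) * (P * b + Q * e).
  by apply: ler_wpM2l => //; rewrite addr_ge0// !mulr_ge0// exprn_ge0.
have s5 : 0 <= P ^+ 3 * Q * b + l * Q * b +
    (P ^+ 2 * Q * C + l * P * Q) * (P * e + Q * b).
  by rewrite !addr_ge0// !mulr_ge0// ?exprn_ge0// ?addr_ge0// !mulr_ge0// exprn_ge0.
have -> : P ^+ 4 * Fu + cutoff_error P Q C l * (e + b) =
    P ^+ 2 * (P * (P * Fu + Q * e)) + (P ^+ 2 * Q * C + l * P * Q) * (P * b + Q * e) + l * Q * e +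
    (P ^+ 3 * Q * b + l * Q * b + (P ^+ 2 * Q * C + l * P * Q) * (P * e + Q * b)).
  by rewrite /cutoff_error; ring.
have s6 : P ^+ 2 * (P * (P * Fu + Q * e) + Q * (C * bf)) + l * P * Q * bf =
    P ^+ 2 * (P * (P * Fu + Q * e)) + (P ^+ 2 * Q * C + l * P * Q) * bf by ring.
lra.
Qed.

Section lower_bound.
Local Opaque Lp_power.
Context (R : realType) (N : nat) (p : R) (Omega : set 'rV[R]_N).
Hypotheses (p_gt1 : 1 < p) (open_Omega : open Omega).
Implicit Types (u : W1p p Omega) (f : 'rV[R]_N -> R) (x : 'rV[R]_N).

Notation mu := (lebesgue_rV R N).

Let p0 : 0 < p. Proof. exact: lt_trans p_gt1. Qed.

Let mO : measurable Omega. Proof. exact: open_measurable_rV. Qed.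

Lemma W1p_fun_Lp_fun u : Lp_fun mu Omega p (fun x => `|u x|).
Proof.
apply: Lp_fun_lty => //; last exact: W1p_fun_Lp.
by apply: measurableT_comp => //; exact: W1p_fun_measurable.
Qed.

Lemma wgrad_Lp_fun u : Lp_fun mu Omega p (fun x => enorm (wgrad u x)).
Proof.
apply: Lp_fun_lty; last exact: wgrad_Lp.
  by move=> x; exact: enorm_ge0.
by apply: measurable_enorm => i; apply: measurable_fun_coord; exact: wgrad_measurable.
Qed.

Lemma measurable_test_fun f (D : set 'rV[R]_N) : test_fun Omega f -> measurable_fun D f.
Proof.
move=> [sf _ _]; apply: measurable_funTS; apply: continuous_measurable_rV.
exact: smooth_continuous.
Qed.

Lemma measurable_test_fun_gradient f (D : set 'rV[R]_N) : test_fun Omega f ->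
  measurable_fun D (gradient f).
Proof. by move=> [sf _ _]; apply: measurable_funTS; exact: measurable_gradient. Qed.

Lemma W1p_subr_Lp_fun u f : test_fun Omega f ->
  Lp_fun mu Omega p (fun x => `|u x - f x|).
Proof.
move=> tf; apply: (Lp_fun_leD mO p_gt1) (W1p_fun_Lp_fun u) (test_fun_Lp p_gt1 mO tf) => //.
  apply: measurableT_comp => //; apply: measurable_funB; first exact: W1p_fun_measurable.
  exact: measurable_test_fun.
by move=> x _; exact: ler_normB.
Qed.

Lemma measurable_wgrad_subr u f i : test_fun Omega f ->
  measurable_fun Omega (fun x => (wgrad u x - gradient f x) 0 i).
Proof.
move=> tf; under eq_fun do rewrite !mxE.
apply: measurable_funB; first by apply: measurable_fun_coord; exact: wgrad_measurable.
have [sf _ _] := tf; apply: measurable_funTS.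
by apply: continuous_measurable_rV; exact: continuous_partial.
Qed.

Lemma wgrad_subr_Lp_fun u f : test_fun Omega f ->
  Lp_fun mu Omega p (fun x => enorm (wgrad u x - gradient f x)).
Proof.
move=> tf.
apply: (Lp_fun_leD mO p_gt1) (wgrad_Lp_fun u) (test_fun_gradient_Lp p_gt1 mO tf).
- by move=> x; exact: enorm_ge0.
- by apply: measurable_enorm => i; exact: measurable_wgrad_subr.
- by move=> x _; apply: le_trans (enormD _ _) _; rewrite enormN.
Qed.

Lemma W1p_norm_lt (f : 'rV[R]_N -> R) (F : 'rV[R]_N -> 'rV[R]_N) (e : R) : 0 < e ->
  Lp_fun mu Omega p (fun x => `|f x|) -> Lp_fun mu Omega p (fun x => enorm (F x)) ->
  (W1p_norm p Omega f F < e%:E)%E ->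
  Lp_power mu Omega p (fun x => `|f x|) + Lp_power mu Omega p (fun x => enorm (F x)) < e `^ p.
Proof.
move=> e0 iF iG; rewrite /W1p_norm (int_funE mO iF) (int_vecE mO iG) -EFinD poweR_EFin lte_fin.
set a := Lp_power _ _ _ _; set b := Lp_power _ _ _ _.
have ab0 : 0 <= a + b by rewrite addr_ge0// Lp_power_ge0.
move: (a + b) ab0 => c c0 ce.
have -> : c = (c `^ p^-1) `^ p by rewrite -powRrM mulVf ?(gt_eqF p0)// powRr1.
by apply: gt0_ltr_powR; rewrite ?nnegrE ?powR_ge0 ?(ltW e0).
Qed.

Lemma W1p_norm_le1 (f : 'rV[R]_N -> R) (F : 'rV[R]_N -> 'rV[R]_N) :
  Lp_fun mu Omega p (fun x => `|f x|) -> Lp_fun mu Omega p (fun x => enorm (F x)) ->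
  (W1p_norm p Omega f F <= 1)%E ->
  Lp_power mu Omega p (fun x => `|f x|) + Lp_power mu Omega p (fun x => enorm (F x)) <= 1.
Proof.
move=> iF iG; rewrite /W1p_norm (int_funE mO iF) (int_vecE mO iG) -EFinD poweR_EFin lee_fin.
set a := Lp_power _ _ _ _; set b := Lp_power _ _ _ _.
have ab0 : 0 <= a + b by rewrite addr_ge0// Lp_power_ge0.
move: (a + b) ab0 => c c0 c1.
have -> : c = (c `^ p^-1) `^ p by rewrite -powRrM mulVf ?(gt_eqF p0)// powRr1.
have <- : 1 `^ p = 1 :> R by rewrite powR1.
by apply: ge0_ler_powR; rewrite ?nnegrE ?powR_ge0 ?(ltW p0).
Qed.

Lemma W01p_approx u (e : R) : 0 < e -> W01p u -> exists f, [/\ test_fun Omega f,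
  Lp_power mu Omega p (fun x => `|u x - f x|) <= e &
  Lp_power mu Omega p (fun x => enorm (wgrad u x - gradient f x)) <= e].
Proof.
move=> e0 /(_ (e `^ p^-1))[|f tf /W1p_norm_lt]; first exact: powR_gt0.
move=> /(_ (powR_gt0 _ e0) (W1p_subr_Lp_fun u tf) (wgrad_subr_Lp_fun u tf)).
rewrite -powRrM mulVf ?(gt_eqF p0)// powRr1 ?(ltW e0)// => h.
exists f; split => //.
  by apply: le_trans (ltW h); rewrite lerDl Lp_power_ge0.
by apply: le_trans (ltW h); rewrite lerDr Lp_power_ge0.
Qed.

(* [S] absorbs the errors made when replacing [u] by a nearby test function and
   then multiplying the latter by a cutoff. *)
Lemma lambda_p_le_W01p (l r k : R) : 0 <= l -> 1 <= r -> 0 < k ->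
  (l%:E <= lambda_p p (Omega `\` closure (eball r)))%E ->
  exists2 S : R, 0 <= S & forall u (e : R), 0 < e -> W01p u ->
    Lp_power mu Omega p (fun x => `|u x|) = 1 ->
    l <= ((1 + k) `^ p) ^+ 4 * Lp_power mu Omega p (fun x => enorm (wgrad u x)) +
      S * (e + Lp_power mu (Omega `&` eball (2 * r)) p (fun x => `|u x|)).
Proof.
move=> l0 r1 k0 hl; have r0 : 0 < r by exact: lt_le_trans r1.
set P := (1 + k) `^ p; pose Q := (1 + k^-1) `^ p; pose C := cutoff_bound R `^ p.
have [P0 Q0 C0] : [/\ 0 <= P, 0 <= Q & 0 <= C] by split; exact: powR_ge0.
exists (cutoff_error P Q C l); first exact: cutoff_error_ge0.
move=> u e e0 Wu u1; have [f [tf fe dfe]] := W01p_approx e0 Wu.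
have [sf _ _] := tf.
have iu := W1p_fun_Lp_fun u; have idu := wgrad_Lp_fun u.
have iuf := W1p_subr_Lp_fun u tf; have iduf := wgrad_subr_Lp_fun u tf.
have jf := test_fun_Lp p_gt1 mO tf; have jdf := test_fun_gradient_Lp p_gt1 mO tf.
have tg := test_fun_cutoff r0 tf; have [sg _ _] := tg.
have mO' : measurable (Omega `\` closure (eball r)).
  by apply: open_measurable_rV; apply: open_setD_ball.
have ig := test_fun_Lp p_gt1 mO tg; have idg := test_fun_gradient_Lp p_gt1 mO tg.
set g := cutoff r * f in tg sg ig idg.
pose E := eball (2 * r) : set 'rV[R]_N.
have mE : measurable E by exact: measurable_eball.
have iuE := Lp_fun_patch mO p_gt1 mE iu.
have ifE := Lp_fun_patch mO p_gt1 mE jf.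
have iufE := Lp_fun_patch mO p_gt1 mE iuf.
have [jf0 mjf _] := jf; have [jdf0 mjdf _] := jdf; have [iu0 miu _] := iu.
have [ifE0 mifE _] := ifE; have [idg0 midg _] := idg.
set Fu := Lp_power _ _ _ _; rewrite -/Fu.
have CdF x : Omega x -> enorm (gradient f x) <=
    enorm (wgrad u x) + enorm (wgrad u x - gradient f x).
  move=> _; rewrite -{1}(subrK (wgrad u x) (gradient f x)) addrC.
  by apply: le_trans (enormD _ _) _; rewrite lerD2l -enormN opprB.
have hFf := le_trans (Lp_power_leD mO p_gt1 jdf0 mjdf CdF idu iduf k0)
  (lerD (lexx _) (ler_wpM2l Q0 dfe)).
have -> : Lp_power mu (Omega `&` eball (2 * r)) p (fun x => `|u x|) =
    Lp_power mu Omega p ((fun x => `|u x|) \_ E) by rewrite Lp_power_patch.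
set b := Lp_power _ _ _ ((fun x => `|u x|) \_ E).
set bf := Lp_power mu Omega p ((fun x => `|f x|) \_ E).
have Cb x : Omega x -> ((fun x => `|f x|) \_ E) x <=
    ((fun x => `|u x|) \_ E) x + ((fun x => `|u x - f x|) \_ E) x.
  move=> _; rewrite /patch; case: ifP => _; last by rewrite addr0.
  by rewrite -{1}(subrK (u x) (f x)) addrC distrC; exact: ler_normD.
have hbf := le_trans (Lp_power_leD mO p_gt1 ifE0 mifE Cb iuE iufE k0)
  (lerD (lexx _) (ler_wpM2l Q0 (le_trans (Lp_power_patch_le mO p_gt1 mE iuf) fe))).
have CdG x : Omega x -> enorm (gradient g x) <=
    enorm (gradient f x) + cutoff_bound R * ((fun x => `|f x|) \_ E) x.
  by move=> _; exact: cutoff_gradient_le.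
have hFg := le_trans (Lp_power_leD mO p_gt1 idg0 midg CdG jdf
  (Lp_funZ mO (cutoff_bound_ge0 R) ifE) k0) (lerD (ler_wpM2l P0 hFf) (lexx _)).
rewrite (Lp_powerZ mO (cutoff_bound_ge0 R) ifE) in hFg.
have Cu x : Omega x -> `|u x| <= `|f x| + `|u x - f x|.
  by move=> _; rewrite -{1}(subrK (f x) (u x)) addrC; exact: ler_normD.
have h1 := le_trans (Lp_power_leD mO p_gt1 iu0 miu Cu jf iuf k0)
  (lerD (lexx _) (ler_wpM2l Q0 fe)).
rewrite u1 in h1.
have Cf x : Omega x -> `|f x| <= `|g x| + ((fun x => `|f x|) \_ E) x.
  move=> _; rewrite /patch; case: ifPn => [_|]; first by rewrite lerDr.
  rewrite notin_setE => /(dotp_ge_eball r0) xr.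
  by rewrite addr0 /g !fctE cutoff_eq1// mul1r.
have hf := Lp_power_leD mO p_gt1 jf0 mjf Cf ig ifE k0.
have hlg := lambda_p_le p_gt1 mO' mO (@subDsetl _ _ _) hl tg.
exact: (cutoff_sum_le l0 P0 Q0 C0 (ltW e0) (Lp_power_ge0 _ _ _ _) hFg h1 hf hlg hbf).
Qed.

End lower_bound.

(** * Every level of the spectrum dominates the exterior eigenvalues *)

Section spectrum_lower_bound.
Local Opaque Lp_power.
Context (R : realType) (N : nat) (p : R) (Omega : set 'rV[R]_N).
Hypotheses (p_gt1 : 1 < p) (open_Omega : open Omega).

Notation mu := (lebesgue_rV R N).

Let p0 : 0 < p. Proof. exact: lt_trans p_gt1. Qed.

Let mO : measurable Omega. Proof. exact: open_measurable_rV. Qed.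

Lemma lambda_p_anti (A B : set 'rV[R]_N) : measurable A -> measurable B ->
  A `<=` B -> (lambda_p p B <= lambda_p p A)%E.
Proof.
move=> mA mB AB; apply: le_ereal_inf => _ [f [tf f1] <-].
have tfB := test_funW AB tf.
have Lf := test_fun_Lp p_gt1 mA tf; have Ldf := test_fun_gradient_Lp p_gt1 mA tf.
have LfB := test_fun_Lp p_gt1 mB tf; have LdfB := test_fun_gradient_Lp p_gt1 mB tf.
exists f; last first.
  rewrite (int_vecE mA Ldf) (int_vecE mB LdfB) (Lp_power_restrict p_gt1 mu AB)//.
  by move=> x /(test_fun_gradient_eq0 tf) ->; rewrite enorm0.
split => //; rewrite (int_funE mB LfB) -f1 (int_funE mA Lf).
rewrite -(Lp_power_restrict p_gt1 mu AB)//.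
by move=> x /(test_fun_eq0 tf) ->; rewrite normr0.
Qed.

Lemma lambda_p_exterior_nd (r s : R) : r <= s ->
  (lambda_p p (Omega `\` closure (eball r)) <=
   lambda_p p (Omega `\` closure (eball s)))%E.
Proof.
move=> rs; apply: lambda_p_anti.
- by apply: open_measurable_rV; apply: open_setD_ball.
- by apply: open_measurable_rV; apply: open_setD_ball.
- apply: setDS; apply: closure_subset => x; rewrite /eball/= => /lt_le_trans; exact.
Qed.

Lemma exists_powR4_lt (m l : R) : 0 <= m -> m < l ->
  exists2 k : R, 0 < k & ((1 + k) `^ p) ^+ 4 * m < l.
Proof.
move=> m0 ml; have [d d0 Hd] := powR_taylor1 (p * 4) (@ltr01 R).
(* The Taylor estimate bounds the power by 1 + k (4 p + 1); the choice of [c] lets the excess use at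
   most half of [l - m], and [m + 1] avoids a division by 0. *)
pose c := 2 * (p * 4 + 1) * (m + 1).
have p41 : 0 < p * 4 + 1 by move: p0; lra.
have m1 : 0 < m + 1 by lra.
have c0 : 0 < c by rewrite /c; apply: mulr_gt0 => //; exact: mulr_gt0.
pose k := Num.min d ((l - m) / c).
have k0 : 0 < k by rewrite lt_min d0 divr_gt0// subr_gt0.
have kd : k <= d by rewrite ge_min lexx.
have kc : k * c <= l - m by rewrite -ler_pdivlMr// ge_min lexx orbT.
exists k => //.
rewrite -powR_mulrn ?powR_ge0// -powRrM.
have := Hd k; rewrite gtr0_norm// mul1r => /(_ kd).
rewrite ler_norml => /andP[_ h].
have h' : (1 + k) `^ (p * 4) * m <= (1 + k * (p * 4 + 1)) * m.
  by apply: ler_wpM2r => //; lra.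
apply: le_lt_trans h' _.
have : 0 < k * (p * 4 + 1) by exact: mulr_gt0.
rewrite /c in kc; nra.
Qed.

Lemma Lp_norm_eq1 (u : W1p p Omega) : Lp_norm p Omega u = 1%E ->
  Lp_power mu Omega p (fun x => `|u x|) = 1.
Proof.
rewrite /Lp_norm (int_funE mO (W1p_fun_Lp_fun u)) poweR_EFin => -[].
have := Lp_power_ge0 mu Omega p (fun x => `|u x|).
move: (Lp_power _ _ _ _) => a a0 a1.
have E : a = (a `^ p^-1) `^ p by rewrite -powRrM mulVf ?(lt0r_neq0 p0)// powRr1.
by rewrite E a1 powR1.
Qed.

Lemma Lp_fun_subset (A : set 'rV[R]_N) (h : 'rV[R]_N -> R) : measurable A ->
  A `<=` Omega -> Lp_fun mu Omega p h -> Lp_fun mu A p h.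
Proof.
move=> mA AO [h0 mh ih]; split => //; first exact: measurable_funS mh.
exact: (integrableS mO).
Qed.

Lemma essential_spectrum_ge (m r : R) : 0 < r -> essential_spectrum p Omega m ->
  (lambda_p p (Omega `\` closure (eball r)) <= m%:E)%E.
Proof.
move=> r0 [u [Wu u1 cvF _] sing]; rewrite leNgt; apply/negP => ml.
(* The bound on the gradient of the cutoff asks for a radius at least 1, and a larger radius only
   strengthens the assumption to be refuted. *)
pose s := Num.max r 1.
have s1 : 1 <= s by rewrite le_max lexx orbT.
have s0 : 0 < s by exact: lt_le_trans s1.
have {}ml : (m%:E < lambda_p p (Omega `\` closure (eball s)))%E.
  apply: lt_le_trans ml _; apply: lambda_p_exterior_nd.
  by rewrite le_max lexx.
(* A real [l] is needed because the exterior eigenvalue may be [+oo]. *)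
have [l ml' ls] : exists2 l : R, m < l &
    (l%:E <= lambda_p p (Omega `\` closure (eball s)))%E.
  move: ml; case: (lambda_p _ _) => [l| |] //; first by rewrite lte_fin; exists l.
  by exists (m + 1); [rewrite ltrDl|rewrite leey].
pose F n := Lp_power mu Omega p (fun x => enorm (wgrad (u n) x)).
have {}cvF : F n @[n --> \oo] --> m.
  rewrite (_ : F = fine \o (fun n => int_vec p Omega (wgrad (u n)))); first exact: fine_cvg.
  by apply/funext => n; rewrite /= (int_vecE mO (wgrad_Lp_fun (u n))).
pose E := eball (2 * s) : set 'rV[R]_N.
have mE : measurable (Omega `&` E) by apply: measurableI => //; exact: measurable_eball.
pose b n := Lp_power mu (Omega `&` E) p (fun x => `|u n x|).
have cvb : (b n) `^ p^-1 @[n --> \oo] --> (0 : R).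
  rewrite (_ : (fun n => _) = fine \o (fun n => Lp_norm p (Omega `&` E) (u n))).
    by apply: fine_cvg; apply: sing; exact: mulr_gt0.
  apply/funext => n.
  have Lb : Lp_fun mu (Omega `&` E) p (fun x => `|u n x|).
    by apply: Lp_fun_subset => //; exact: W1p_fun_Lp_fun.
  by rewrite /= /Lp_norm (int_funE mE Lb).
have m0 : 0 <= m.
  rewrite leNgt; apply/negP => m0.
  have /filter_ex[n] : \forall n \near \oo, F n < 0 by apply: cvgr_lt m0.
  by rewrite ltNge Lp_power_ge0.
have [k k0 kl] := exists_powR4_lt m0 ml'.
have l0 : 0 <= l by exact: le_trans m0 (ltW ml').
have [S S0 HS] := lambda_p_le_W01p p_gt1 open_Omega l0 s1 k0 ls.
set P := ((1 + k) `^ p) ^+ 4 in kl HS.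
have P0 : 0 <= P by rewrite exprn_ge0// powR_ge0.
(* The energy excess, the approximation error and the mass in the ball are all bounded by the same
   [t]; together they cost at most [t * (P + 2 * S)], less than half of the gap [l - P * m]. *)
pose D := P + 2 * S + 1.
have D0 : 0 < D by rewrite ltr_pwDr// addr_ge0// mulr_ge0.
pose t := (l - P * m) / (2 * D).
have t0 : 0 < t by rewrite divr_gt0 ?mulr_gt0// subr_gt0.
have tD : t * D = (l - P * m) / 2 by rewrite /t; field; rewrite gt_eqF.
have tp0 : 0 < t `^ p^-1 by rewrite powR_gt0.
have /filter_ex[n [Fn bn]] : \forall n \near \oo, F n < m + t /\ b n `^ p^-1 < t `^ p^-1.
  apply: filterI; first by apply: cvgr_lt cvF _ _; rewrite ltrDl.
  exact: cvgr_lt cvb _ tp0.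
have b0 : 0 <= b n by exact: Lp_power_ge0.
have bt : b n < t.
  rewrite ltNge; apply/negP => tb; move: bn; rewrite ltNge => /negP; apply.
  by apply: ge0_ler_powR; rewrite ?nnegrE ?invr_ge0 ?(ltW p0) ?(ltW t0).
have := HS (u n) t t0 (Wu n) (Lp_norm_eq1 (u1 n)).
rewrite -/(F n) -/(b n) => Hl.
have h1 : P * F n <= P * (m + t) by apply: ler_wpM2l => //; exact: ltW.
have h2 : S * (t + b n) <= S * (t + t) by apply: ler_wpM2l => //; rewrite lerD2l ltW.
have : l <= P * m + (t * D - t) by apply: le_trans Hl _; rewrite /D; lra.
by rewrite tD; lra.
Qed.

End spectrum_lower_bound.

(** * Almost minimizers are almost critical *)

(** With w = v + t g, insert the expansions of the energy and of the mass into [l * Gw <= Fw]. Here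
    [s] is p t, [D] and [P] are the two pairings, and [Cf], [Gf] bound the energy and the mass of
    g. *)
Lemma first_order_le (R : realDomainType) (s l et Fw Gw Fg Gg Fv Gv Cf Gf D P : R) :
  0 <= et -> 0 <= l -> l * Gw <= Fw -> Fg <= Cf -> Gg <= Gf ->
  `|Fw - Fv - s * D| <= et * (Fv + Fg) -> `|Gw - Gv - s * P| <= et * (Gv + Gg) ->
  - (s * (D - l * P)) <= Fv - l * Gv + et * (Fv + Cf + l * (Gv + Gf)).
Proof.
move=> et0 l0 hw hFg hGg; rewrite !ler_norml => /andP[_ h1] /andP[h2 _].
have s1 : et * (Fv + Fg) <= et * (Fv + Cf) by rewrite ler_wpM2l// lerD2l.
have s2 : et * (Gv + Gg) <= et * (Gv + Gf) by rewrite ler_wpM2l// lerD2l.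
have h2' : Gv + s * P - et * (Gv + Gf) <= Gw by lra.
have s3 := ler_wpM2l l0 h2'.
have h1' : Fw <= Fv + s * D + et * (Fv + Cf) by lra.
have := le_trans s3 (le_trans hw h1').
rewrite !mulrBr !mulrDr; lra.
Qed.

Lemma weighted_sum_le2 (R : realDomainType) (w a b : R) :
  0 <= w -> a <= 1 -> b <= 1 -> w * a + w * b <= 2 * w.
Proof. by move=> w0 a1 b1; rewrite -mulrDr mulrC ler_wpM2r// (_ : 2 = 1 + 1)// lerD. Qed.

(** The defect [F - l] is at most [2 * dl], hence a quarter of [s * t * e0]; [M] bounds the factor
    of [e * t], which contributes another quarter. *)
Lemma critical_step_le (R : realFieldType) (s e t e0 dl E l F c M Cf Gf G X : R) :
  0 < s * t -> 0 <= e * t -> e * M = s * e0 / 4 -> dl <= 1 -> dl <= s * t * e0 / 8 ->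
  E - l <= dl -> F <= E + dl -> 0 <= l -> l <= E -> 0 <= Gf -> Gf <= G -> Cf <= c ->
  M = E + 1 + c + E * (1 + G) ->
  s * t * X <= F - l + e * t * (F + Cf + l * (1 + Gf)) -> X <= e0 / 2.
Proof.
move=> st0 et0 eM dl1 dl2 El hF l0 lE Gf0 GfG Cfc ME hX.
rewrite -(ler_pM2l st0); apply: le_trans hX _.
have lf : l * (1 + Gf) <= E * (1 + G) by apply: ler_pM => //; lra.
have FM : F + Cf + l * (1 + Gf) <= M by lra.
have := ler_wpM2l et0 FM.
have -> : e * t * M = s * t * e0 / 4 by rewrite mulrAC eM; field.
lra.
Qed.

(** [D1], [P1] are tested against phi, [D2], [P2] against a nearby test function. The derivative at
    level [l] takes half of [e0]; replacing phi by the test function and [E] by [l] takes a quarter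
    each. *)
Lemma critical_sum_le (R : realFieldType) (E l dl e0 k h F G D1 D2 P1 P2 : R) :
  0 <= l -> l <= E -> E - l <= dl -> dl <= e0 / 8 -> dl <= 1 -> 0 <= k ->
  F <= E + dl -> G = 1 ->
  `|D2 - l * P2| <= e0 / 2 -> `|D1 - D2| <= k * F + h -> `|P1 - P2| <= k * G + h ->
  `|P1| <= 2 -> k * (2 * E + 1) <= e0 / 8 -> (1 + E) * h <= e0 / 8 ->
  `|D1 - E * P1| <= e0.
Proof.
move=> l0 lE El dl8 dl1 k0 hF -> b1 b2 b3 b4 kE hE.
have b5 : `|l * (P1 - P2)| <= E * (k * 1 + h).
  by rewrite normrM (ger0_norm l0); apply: ler_pM.
have b6 : `|(E - l) * P1| <= e0 / 8 * 2.
  have El0 : 0 <= E - l by rewrite subr_ge0.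
  by rewrite normrM (ger0_norm El0); apply: ler_pM => //; exact: le_trans El dl8.
have b7 : k * F <= k * (E + 1) by apply: ler_wpM2l => //; lra.
have -> : D1 - E * P1 = (D1 - D2) + (D2 - l * P2) - l * (P1 - P2) - (E - l) * P1 by ring.
apply: le_trans (ler_normB _ _) _.
apply: le_trans (lerD (ler_normB _ _) (lexx _)) _.
apply: le_trans (lerD (lerD (ler_normD _ _) (lexx _)) (lexx _)) _.
lra.
Qed.

Section almost_critical.
Local Opaque Lp_power pairing.
Context (R : realType) (N : nat) (p : R) (Omega : set 'rV[R]_N).
Hypotheses (p_gt1 : 1 < p) (open_Omega : open Omega).
Implicit Types (v f g : 'rV[R]_N -> R) (F : 'rV[R]_N -> 'rV[R]_N) (phi : W1p p Omega).

Notation mu := (lebesgue_rV R N).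
Notation Lp f := (Lp_power mu Omega p (fun x => `|f x|)).
Notation Lpv F := (Lp_power mu Omega p (fun x => enorm (F x))).
Notation pair_fun v f :=
  (pairing mu Omega p (fun x => `|v x|) (fun x => v x * f x)).
Notation pair_vec F G :=
  (pairing mu Omega p (fun x => enorm (F x)) (fun x => dotp (F x) (G x))).

Let p0 : 0 < p. Proof. exact: lt_trans p_gt1. Qed.

Let mO : measurable Omega. Proof. exact: open_measurable_rV. Qed.

Lemma sqr_powR_half (a : R) : 0 <= a -> (a ^+ 2) `^ (p / 2) = a `^ p.
Proof. by move=> a0; rewrite -powR_mulrn// -powRrM; congr (_ `^ _); field. Qed.

Lemma normrM_le (a b : R) : `|a * b| <= `|a| * `|b|.
Proof. by rewrite normrM. Qed.

Lemma measurable_funM_test v h : test_fun Omega v -> measurable_fun Omega h ->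
  measurable_fun Omega (fun x => v x * h x).
Proof. by move=> tv mh; apply: measurable_funM => //; exact: measurable_test_fun tv. Qed.

Lemma measurable_dotp_test v F : test_fun Omega v ->
  (forall i, measurable_fun Omega (fun x => F x 0 i)) ->
  measurable_fun Omega (fun x => dotp (gradient v x) (F x)).
Proof.
move=> tv mF; apply: measurable_dotp => // i.
by apply: measurable_fun_coord; exact: measurable_test_fun_gradient tv.
Qed.

Lemma measurable_test_fun_gradient_coord f i : test_fun Omega f ->
  measurable_fun Omega (fun x => gradient f x 0 i).
Proof. by move=> tf; apply: measurable_fun_coord; exact: measurable_test_fun_gradient tf. Qed.

(** The estimate provided by [powR_expand], isolated so that [t] is fixed before any function is
    chosen. *)
Definition expansion_step (e t : R) := forall A B c : R, 0 <= A -> 0 <= B ->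
  `|c| <= A * B ->
  `|(A ^+ 2 + 2 * t * c + t ^+ 2 * B ^+ 2) `^ (p / 2) - A `^ p
    - p * t * (A `^ (p - 2) * c)| <= e * t * (A `^ p + B `^ p).

Lemma Lp_expand (e t : R) v g : expansion_step e t ->
  test_fun Omega v -> test_fun Omega g ->
  `|Lp (v + (fun x => t * g x)) - Lp v - p * t * pair_fun v g|
    <= e * t * (Lp v + Lp g).
Proof.
move=> het tv tg.
have tw := test_funD tv (test_funZ t tg).
have Lv := test_fun_Lp p_gt1 mO tv; have Lg := test_fun_Lp p_gt1 mO tg.
have Lw := test_fun_Lp p_gt1 mO tw; have [w0 mw _] := Lw.
have mc : measurable_fun Omega (fun x => v x * g x).
  by apply: measurable_funM_test => //; exact: measurable_test_fun tg.
have cAB x := normrM_le (v x) (g x).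
apply: (pairing_expand mO p_gt1 Lv Lg mc cAB w0 mw _ Lw) => x.
have := het `|v x| `|g x| (v x * g x) (normr_ge0 _) (normr_ge0 _) (cAB x).
rewrite (_ : _ ^+ 2 + _ + _ = `|(v + (fun x => t * g x)) x| ^+ 2).
  by rewrite sqr_powR_half.
by rewrite !real_normK ?num_real// !fctE; ring.
Qed.

Lemma Lp_gradient_expand (e t : R) v g : expansion_step e t ->
  test_fun Omega v -> test_fun Omega g ->
  `|Lpv (gradient (v + (fun x => t * g x))) - Lpv (gradient v)
    - p * t * pair_vec (gradient v) (gradient g)|
    <= e * t * (Lpv (gradient v) + Lpv (gradient g)).
Proof.
move=> het tv tg.
have tw := test_funD tv (test_funZ t tg).
have Lv := test_fun_gradient_Lp p_gt1 mO tv.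
have Lg := test_fun_gradient_Lp p_gt1 mO tg.
have Lw := test_fun_gradient_Lp p_gt1 mO tw; have [w0 mw _] := Lw.
have mc : measurable_fun Omega (fun x => dotp (gradient v x) (gradient g x)).
  by apply: measurable_dotp_test => // i; exact: measurable_test_fun_gradient_coord.
have cAB x := normr_dotp (gradient v x) (gradient g x).
apply: (pairing_expand mO p_gt1 Lv Lg mc cAB w0 mw _ Lw) => x.
have := het _ _ _ (enorm_ge0 _) (enorm_ge0 _) (cAB x).
rewrite (_ : _ ^+ 2 + _ + _ = enorm (gradient (v + (fun x => t * g x)) x) ^+ 2).
  by rewrite sqr_powR_half// enorm_ge0.
have [sv _ _] := tv; have [sg _ _] := tg.
rewrite (gradientD _ sv (smoothZ _ sg)) (gradientZ _ _ sg).
rewrite !sqr_enorm dotpDl !dotpDr !dotpZl !dotpZr.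
by rewrite (dotpC (gradient g x) (gradient v x)); ring.
Qed.

Lemma pair_fun_cutoff (r : R) v f : 0 < r ->
  test_fun (Omega `\` closure (eball (2 * r))) v ->
  pair_fun v (cutoff r * f) = pair_fun v f.
Proof.
move=> r0 tv; apply: eq_Rintegral => x _ /=.
have [xA|xA] := pselect ((Omega `\` closure (eball (2 * r))) x); last first.
  by rewrite (test_fun_eq0 tv xA) !mul0r.
have xr : ~ eball (2 * r) x by move=> /subset_closure; case: xA.
by rewrite !fctE cutoff_eq1 ?mul1r//; exact: dotp_ge_eball.
Qed.

Lemma pair_vec_cutoff (r : R) v f : 0 < r -> smooth f ->
  test_fun (Omega `\` closure (eball (2 * r))) v ->
  pair_vec (gradient v) (gradient (cutoff r * f)) = pair_vec (gradient v) (gradient f).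
Proof.
move=> r0 sf tv; apply: eq_Rintegral => x _ /=.
have [xA|xA] := pselect ((Omega `\` closure (eball (2 * r))) x); last first.
  by rewrite (test_fun_gradient_eq0 tv xA) !(dotpC 0) !dotp0.
have xr : 3 * r ^+ 2 <= dotp x x.
  by apply: dotp_ge_eball => // /subset_closure; case: xA.
rewrite (gradientM _ (smooth_cutoff r) sf) gradient_cutoff_eq0// cutoff_eq1//.
by rewrite scaler0 addr0 scale1r.
Qed.

(** Both constants of [Lp_power_leD] at [k = 1]. *)
Let T : R := 2 `^ p.

Let T0 : 0 <= T. Proof. exact: powR_ge0. Qed.

Lemma Lp_cutoff_le (r : R) f : 0 < r -> test_fun Omega f -> Lp (cutoff r * f) <= Lp f.
Proof.
move=> r0 tf; have tg := test_funW (@subDsetl _ _ _) (test_fun_cutoff r0 tf).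
have [g0 mg _] := test_fun_Lp p_gt1 mO tg.
apply: (Lp_power_le mO p_gt1 g0 mg) (test_fun_Lp p_gt1 mO tf) => x _.
exact: normr_cutoff_le.
Qed.

Lemma Lp_gradient_cutoff_le (r : R) f : 1 <= r -> test_fun Omega f ->
  Lpv (gradient (cutoff r * f)) <=
    T * Lpv (gradient f) + T * (cutoff_bound R `^ p * Lp f).
Proof.
move=> r1 tf; have r0 : 0 < r by exact: lt_le_trans r1.
have tg := test_funW (@subDsetl _ _ _) (test_fun_cutoff r0 tf).
have [sf _ _] := tf.
have [g0 mg _] := test_fun_gradient_Lp p_gt1 mO tg.
have Lf := test_fun_Lp p_gt1 mO tf; have [f0 _ _] := Lf.
have Ldf := test_fun_gradient_Lp p_gt1 mO tf.
have LC := Lp_funZ mO (cutoff_bound_ge0 R) Lf.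
have := Lp_power_leD mO p_gt1 g0 mg _ Ldf LC ltr01.
rewrite invr1 (_ : (1 + 1) `^ p = T)// (Lp_powerZ mO (cutoff_bound_ge0 R) Lf); apply.
move=> x _; apply: le_trans (cutoff_gradient_le x sf r1) _.
rewrite lerD2l; apply: ler_wpM2l; first exact: cutoff_bound_ge0.
by rewrite /patch; case: ifP.
Qed.

(* [w = v + t g] is admissible for [lambda_p] outside the ball of radius [r], so
   [l * Lp w <= Lp (grad w)]; both sides are expanded at first order in [t]. *)
Lemma almost_critical_one_sided (e t l r : R) v f : 0 <= e -> 0 < t ->
  expansion_step e t -> 0 <= l -> 1 <= r ->
  (l%:E <= lambda_p p (Omega `\` closure (eball r)))%E ->
  test_fun (Omega `\` closure (eball (2 * r))) v -> test_fun Omega f ->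
  - (p * t * (pair_vec (gradient v) (gradient f) - l * pair_fun v f)) <=
  Lpv (gradient v) - l * Lp v + e * t * (Lpv (gradient v) +
   (T * Lpv (gradient f) + T * (cutoff_bound R `^ p * Lp f)) + l * (Lp v + Lp f)).
Proof.
move=> e0 t0 het l0 r1 hl tv tf; have r0 : 0 < r by exact: lt_le_trans r1.
have [sf _ _] := tf.
have tvO := test_funW (@subDsetl _ _ _) tv.
have tg' := test_fun_cutoff r0 tf; have tg := test_funW (@subDsetl _ _ _) tg'.
have r2 : r <= 2 * r by rewrite ler_peMl ?(ltW r0)// ler1n.
have tv' : test_fun (Omega `\` closure (eball r)) v.
  apply: test_funW tv; apply: setDS; apply: closure_subset => x.
  by rewrite /eball/= => /lt_le_trans; exact.
have mO' : measurable (Omega `\` closure (eball r)).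
  by apply: open_measurable_rV; apply: open_setD_ball.
have hw := lambda_p_le p_gt1 mO' mO (@subDsetl _ _ _) hl (test_funD tv' (test_funZ t tg')).
have H1 := Lp_expand het tvO tg; have H2 := Lp_gradient_expand het tvO tg.
rewrite (pair_fun_cutoff f r0 tv) in H1; rewrite (pair_vec_cutoff r0 sf tv) in H2.
have et0 : 0 <= e * t by rewrite mulr_ge0// ltW.
exact: (first_order_le et0 l0 hw (Lp_gradient_cutoff_le r1 tf) (Lp_cutoff_le r0 tf) H2 H1).
Qed.

Lemma pairing_opp v f : test_fun Omega v -> test_fun Omega f ->
  pair_fun v (fun x => -1 * f x) = - pair_fun v f /\
  pair_vec (gradient v) (gradient (fun x => -1 * f x)) =
  - pair_vec (gradient v) (gradient f).
Proof.
move=> tv tf; have [sf _ _] := tf.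
have Lv := test_fun_Lp p_gt1 mO tv; have Lf := test_fun_Lp p_gt1 mO tf.
have Ldv := test_fun_gradient_Lp p_gt1 mO tv.
have Ldf := test_fun_gradient_Lp p_gt1 mO tf.
have i1 := integrable_pairing mO p_gt1 Lv Lf
  (measurable_funM_test tv (measurable_test_fun tf)) (fun x => normrM_le (v x) (f x)).
have i2 := integrable_pairing mO p_gt1 Ldv Ldf
  (measurable_dotp_test tv (fun i => measurable_test_fun_gradient_coord i tf))
  (fun x => normr_dotp (gradient v x) (gradient f x)).
split; rewrite -[RHS]mulN1r -pairingZ//; congr pairing; apply/funext => x.
  by rewrite mulrCA.
by rewrite gradientZ// dotpZr.
Qed.

(** Apply the one-sided bound to f and to -f: the right-hand side is even in f. *)
Lemma almost_critical_test (e t l r : R) v f : 0 <= e -> 0 < t ->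
  expansion_step e t -> 0 <= l -> 1 <= r ->
  (l%:E <= lambda_p p (Omega `\` closure (eball r)))%E ->
  test_fun (Omega `\` closure (eball (2 * r))) v -> test_fun Omega f ->
  p * t * `|pair_vec (gradient v) (gradient f) - l * pair_fun v f| <=
  Lpv (gradient v) - l * Lp v + e * t * (Lpv (gradient v) +
   (T * Lpv (gradient f) + T * (cutoff_bound R `^ p * Lp f)) + l * (Lp v + Lp f)).
Proof.
move=> e0 t0 het l0 r1 hl tv tf.
have [sf _ _] := tf.
have tvO := test_funW (@subDsetl _ _ _) tv.
have H1 := almost_critical_one_sided e0 t0 het l0 r1 hl tv tf.
have := almost_critical_one_sided e0 t0 het l0 r1 hl tv (test_funZ (-1) tf).
have [-> ->] := pairing_opp tvO tf.
have -> : (fun x => `|-1 * f x|) = (fun x => `|f x|).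
  by apply/funext => x; rewrite mulN1r normrN.
have -> : (fun x => enorm (gradient (fun x => -1 * f x) x)) =
    (fun x => enorm (gradient f x)).
  by apply/funext => x; rewrite (gradientZ _ _ sf) scaleN1r enormN.
move=> H2; rewrite -(gtr0_norm (mulr_gt0 p0 t0)) -normrM ler_norml.
apply/andP; split; first by rewrite lerNl.
apply: le_trans H2; rewrite le_eqVlt; apply/orP; left; apply/eqP; ring.
Qed.

Lemma pairing_W1p_subr v f phi (k : R) : test_fun Omega v -> test_fun Omega f -> 0 < k ->
  `|pair_fun v phi - pair_fun v f| <=
     k * Lp v + k^-1 `^ (p - 1) * Lp_power mu Omega p (fun x => `|phi x - f x|) /\
  `|pair_vec (gradient v) (wgrad phi) - pair_vec (gradient v) (gradient f)| <=
     k * Lpv (gradient v) +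
     k^-1 `^ (p - 1) * Lp_power mu Omega p (fun x => enorm (wgrad phi x - gradient f x)).
Proof.
move=> tv tf k0; have [sf _ _] := tf.
have Lv := test_fun_Lp p_gt1 mO tv; have Lf := test_fun_Lp p_gt1 mO tf.
have Ldv := test_fun_gradient_Lp p_gt1 mO tv.
have Ldf := test_fun_gradient_Lp p_gt1 mO tf.
have i1 := integrable_pairing mO p_gt1 Lv Lf
  (measurable_funM_test tv (measurable_test_fun tf)) (fun x => normrM_le (v x) (f x)).
have i2 := integrable_pairing mO p_gt1 Ldv Ldf
  (measurable_dotp_test tv (fun i => measurable_test_fun_gradient_coord i tf))
  (fun x => normr_dotp (gradient v x) (gradient f x)).
have i3 := integrable_pairing mO p_gt1 Lv (W1p_fun_Lp_fun phi)
  (measurable_funM_test tv (W1p_fun_measurable phi)) (fun x => normrM_le (v x) (phi x)).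
have i4 := integrable_pairing mO p_gt1 Ldv (wgrad_Lp_fun phi)
  (measurable_dotp_test tv (fun i => measurable_fun_coord i (wgrad_measurable phi)))
  (fun x => normr_dotp (gradient v x) (wgrad phi x)).
split; rewrite -pairingB//.
  have -> : (fun x => v x * phi x - v x * f x) = (fun x => v x * (phi x - f x)).
    by apply/funext => x; rewrite mulrBr.
  apply: (pairing_le mO p_gt1 Lv (W1p_subr_Lp_fun p_gt1 open_Omega phi tf)) => //.
    apply: measurable_funM_test => //; apply: measurable_funB; first exact: W1p_fun_measurable.
    exact: measurable_test_fun tf.
  by move=> x; exact: normrM_le.
have -> : (fun x => dotp (gradient v x) (wgrad phi x) - dotp (gradient v x) (gradient f x)) =
    (fun x => dotp (gradient v x) (wgrad phi x - gradient f x)).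
  by apply/funext => x; rewrite dotpDr -(scaleN1r (gradient f x)) dotpZr mulN1r.
apply: (pairing_le mO p_gt1 Ldv (wgrad_subr_Lp_fun p_gt1 open_Omega phi tf)) => //.
  by apply: measurable_dotp_test => // i; exact: measurable_wgrad_subr.
by move=> x; exact: normr_dotp.
Qed.

Lemma pair_fun_W1p_le v phi : test_fun Omega v ->
  `|pair_fun v phi| <= Lp v + Lp phi.
Proof.
move=> tv; have Lv := test_fun_Lp p_gt1 mO tv.
have := pairing_le mO p_gt1 Lv (W1p_fun_Lp_fun phi)
  (measurable_funM_test tv (W1p_fun_measurable phi)) (fun x => normrM_le (v x) (phi x)) ltr01.
by rewrite invr1 powR1 !mul1r.
Qed.

Lemma W01p_approx_le phi (e : R) : 0 < e -> e <= 1 -> W01p phi ->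
  Lp phi + Lpv (wgrad phi) <= 1 -> exists f, [/\ test_fun Omega f,
  Lp_power mu Omega p (fun x => `|phi x - f x|) <= e,
  Lp_power mu Omega p (fun x => enorm (wgrad phi x - gradient f x)) <= e,
  Lp f <= 2 * T & Lpv (gradient f) <= 2 * T].
Proof.
move=> e0 e1 Wphi phi1.
have Lphi0 := Lp_power_ge0 mu Omega p (fun x => `|phi x|).
have Ldphi0 := Lp_power_ge0 mu Omega p (fun x => enorm (wgrad phi x)).
have [f [tf h1 h2]] := W01p_approx p_gt1 open_Omega e0 Wphi.
have [f0 mf _] := test_fun_Lp p_gt1 mO tf.
have [df0 mdf _] := test_fun_gradient_Lp p_gt1 mO tf.
have C x : Omega x -> `|f x| <= `|phi x| + `|phi x - f x|.
  by move=> _; rewrite -{1}(subrK (phi x) (f x)) addrC (distrC (phi x)); exact: ler_normD.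
have dC x : Omega x -> enorm (gradient f x) <=
    enorm (wgrad phi x) + enorm (wgrad phi x - gradient f x).
  move=> _; rewrite -{1}(subrK (wgrad phi x) (gradient f x)) addrC.
  by apply: le_trans (enormD _ _) _; rewrite lerD2l -enormN opprB.
have := Lp_power_leD mO p_gt1 f0 mf C (W1p_fun_Lp_fun phi)
  (W1p_subr_Lp_fun p_gt1 open_Omega phi tf) ltr01.
have := Lp_power_leD mO p_gt1 df0 mdf dC (wgrad_Lp_fun phi)
  (wgrad_subr_Lp_fun p_gt1 open_Omega phi tf) ltr01.
rewrite invr1 (_ : (1 + 1) `^ p = T)// => h3 h4.
exists f; split => //.
  apply: le_trans h4 (weighted_sum_le2 T0 _ (le_trans h1 e1)).
  by apply: le_trans phi1; rewrite lerDl.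
apply: le_trans h3 (weighted_sum_le2 T0 _ (le_trans h2 e1)).
by apply: le_trans phi1; rewrite lerDr.
Qed.

(** The bound of [Lp_gradient_cutoff_le] for an f as in [W01p_approx_le], whose mass and energy are
    at most [2 * T]. *)
Let c1 : R := T * (2 * T) + T * (cutoff_bound R `^ p * (2 * T)).

Let c10 : 0 <= c1.
Proof. by rewrite addr_ge0// !mulr_ge0// powR_ge0. Qed.

(* A nonnegative functional which is small at [v] has a small derivative at
   [v], here tested against [phi] in the unit ball, uniformly in the radius. *)
Lemma almost_critical (E e0 : R) : 0 <= E -> 0 < e0 -> exists2 dl : R, 0 < dl &
  forall (r l : R) v phi, 1 <= r -> 0 <= l -> l <= E -> E - l <= dl ->
    (l%:E <= lambda_p p (Omega `\` closure (eball r)))%E ->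
    test_fun (Omega `\` closure (eball (2 * r))) v -> Lp v = 1 ->
    Lpv (gradient v) <= E + dl -> W01p phi -> Lp phi + Lpv (wgrad phi) <= 1 ->
    `|pair_vec (gradient v) (wgrad phi) - E * pair_fun v phi| <= e0.
Proof.
move=> E0 e00.
(* Bounds the factor of [e * t] in [almost_critical_test], given [dl <= 1]. *)
pose M := E + 1 + c1 + E * (1 + 2 * T).
have M0 : 0 < M.
  have : 0 <= E * (1 + 2 * T) by rewrite mulr_ge0// addr_ge0// mulr_ge0.
  by rewrite /M; move: c10; lra.
pose e := p * e0 / (4 * M).
have e_gt0 : 0 < e by rewrite divr_gt0 ?mulr_gt0.
have eM : e * M = p * e0 / 4 by rewrite /e; field; rewrite gt_eqF.
have [t [t0 _ het]] := powR_expand p_gt1 e_gt0.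
(* Chosen after [t]: the defect of v must be small compared with the step of the expansion. *)
pose dl := Num.min 1 (Num.min (p * t * e0 / 8) (e0 / 8)).
have dl0 : 0 < dl by rewrite !lt_min ltr01 !divr_gt0 ?mulr_gt0.
have dl1 : dl <= 1 by rewrite ge_min lexx.
have dl2 : dl <= p * t * e0 / 8 by rewrite !ge_min lexx !orbT.
have dl3 : dl <= e0 / 8 by rewrite !ge_min lexx !orbT.
pose k := e0 / (8 * (2 * E + 1)).
have E1 : 0 < 2 * E + 1 by lra.
have k0 : 0 < k by rewrite divr_gt0 ?mulr_gt0.
have kE : k * (2 * E + 1) <= e0 / 8.
  by rewrite le_eqVlt; apply/orP; left; apply/eqP; rewrite /k; field; rewrite gt_eqF.
pose k' := k^-1 `^ (p - 1).
have k'0 : 0 <= k' by exact: powR_ge0.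
(* The accuracy with which phi is approximated. It comes after [k]: a small [k] tames the powers of
   v, which do not tend to 0, and makes the weight [k'] of the approximation error large. *)
pose n := Num.min 1 (e0 / (8 * (1 + E) * (k' + 1))).
have k'1 : 0 < k' + 1 by lra.
have E2 : 0 < 1 + E by lra.
have n0 : 0 < n by rewrite lt_min ltr01 divr_gt0 ?mulr_gt0.
have n1 : n <= 1 by rewrite ge_min lexx.
have nE : (1 + E) * (k' * n) <= e0 / 8.
  have : n * (8 * (1 + E) * (k' + 1)) <= e0.
    by rewrite -ler_pdivlMr ?mulr_gt0// ge_min lexx orbT.
  have : 0 <= n * (1 + E) by rewrite mulr_ge0// ltW.
  lra.
exists dl => // r l v phi r1 l0 lE El hl tv v1 hF Wphi phi1.
have tvO := test_funW (@subDsetl _ _ _) tv.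
have [f [tf f1 df1 f2 df2]] := W01p_approx_le n0 n1 Wphi phi1.
have [b1 b2] := pairing_W1p_subr phi tvO tf k0.
have b3 := pair_fun_W1p_le phi tvO.
have b4 := almost_critical_test (ltW e_gt0) t0 het l0 r1 hl tv tf.
have dphi0 := Lp_power_ge0 mu Omega p (fun x => enorm (wgrad phi x)).
have f0 := Lp_power_ge0 mu Omega p (fun x => `|f x|).
have phi1' : Lp phi <= 1 by apply: le_trans phi1; rewrite lerDl.
have b3' : `|pair_fun v phi| <= 2 by apply: le_trans b3 _; rewrite v1 (_ : 2 = 1 + 1)// lerD2l.
have b1' := le_trans b1 (lerD (lexx _) (ler_wpM2l k'0 f1)).
have b2' := le_trans b2 (lerD (lexx _) (ler_wpM2l k'0 df1)).
have c1f : T * Lpv (gradient f) + T * (cutoff_bound R `^ p * Lp f) <= c1.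
  exact: lerD (ler_wpM2l T0 df2) (ler_wpM2l T0 (ler_wpM2l (powR_ge0 _ _) f2)).
have et0 : 0 <= e * t by exact: mulr_ge0 (ltW e_gt0) (ltW t0).
rewrite v1 mulr1 in b4.
have b4' := critical_step_le (mulr_gt0 p0 t0) et0 eM dl1 dl2 El hF l0 lE f0 f2 c1f erefl b4.
exact: (critical_sum_le l0 lE El dl3 dl1 (ltW k0) hF v1 b4' b2' b1' b3' kE nE).
Qed.

End almost_critical.

(** * Test functions as elements of the Sobolev space *)

Section test_fun_W1p.
Context (R : realType) (N : nat) (p : R) (Omega : set 'rV[R]_N).
Hypotheses (p_gt1 : 1 < p) (open_Omega : open Omega).
Implicit Types f : 'rV[R]_N -> R.

Notation mu := (lebesgue_rV R N).

Let p0 : 0 < p. Proof. exact: lt_trans p_gt1. Qed.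

Let mO : measurable Omega. Proof. exact: open_measurable_rV. Qed.

Lemma Rintegral_restrict (h : 'rV[R]_N -> R) : (forall x, ~ Omega x -> h x = 0) ->
  \int[mu]_(x in Omega) h x = \int[mu]_x h x.
Proof.
move=> h0; rewrite Rintegral_mkcond; congr (Rintegral _ _ _); apply/funext => x.
by rewrite /patch; case: ifPn => //; rewrite notin_setE => /h0.
Qed.

Lemma weak_gradient_test f : test_fun Omega f -> weak_gradient Omega f (gradient f).
Proof.
move=> tf psi i tpsi; have [spsi _ _] := tpsi.
rewrite !Rintegral_restrict; last 2 first.
- by move=> x xO; rewrite (test_fun_eq0 tpsi xO) mulr0.
- by move=> x xO; rewrite (test_fun_eq0 tf xO) mul0r.
rewrite /Rintegral (integration_by_parts_test i tf spsi) fineN.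
by under eq_integral do rewrite mxE.
Qed.

Lemma int_fun_test f : test_fun Omega f -> (int_fun p Omega f < +oo)%E.
Proof. by move=> tf; rewrite (int_funE mO (test_fun_Lp p_gt1 mO tf)) ltry. Qed.

Lemma int_vec_test f : test_fun Omega f -> (int_vec p Omega (gradient f) < +oo)%E.
Proof. by move=> tf; rewrite (int_vecE mO (test_fun_gradient_Lp p_gt1 mO tf)) ltry. Qed.

Definition test_W1p f (tf : test_fun Omega f) : W1p p Omega :=
  Build_W1p (measurable_test_fun tf) (measurable_test_fun_gradient tf)
    (int_fun_test tf) (int_vec_test tf) (weak_gradient_test tf).

Lemma test_W1p_W01p f (tf : test_fun Omega f) : W01p (test_W1p tf).
Proof.
move=> e e0; exists f => //.
rewrite (_ : W1p_norm _ _ _ _ = 0%E) ?lte_fin//.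
rewrite /W1p_norm /int_fun /int_vec !integral0_eq.
- by rewrite adde0 poweR0r// invr_eq0 gt_eqF.
- by move=> x _ /=; rewrite subrr enorm0 powR0// gt_eqF.
- by move=> x _ /=; rewrite subrr normr0 powR0// gt_eqF.
Qed.

(** The supremum runs over a set containing the zero function, so it is not [-oo]. *)
Lemma W01p_dual_norm_ge0 (F : W1p p Omega -> R) : (0 <= W01p_dual_norm F)%E.
Proof.
have t0 := @test_fun0 R N Omega.
apply: (@le_trans _ _ (`|F (test_W1p t0)|%:E)); first by rewrite lee_fin.
apply: ereal_sup_ubound; exists (test_W1p t0) => //; split; first exact: test_W1p_W01p.
rewrite (_ : W1p_norm _ _ _ _ = 0%E) ?lee_fin//.
rewrite /W1p_norm /int_fun /int_vec !integral0_eq.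
- by rewrite adde0 poweR0r// invr_eq0 gt_eqF.
- move=> x _ /=; rewrite gradient_notin_fsupport ?enorm0 ?powR0// ?gt_eqF//.
  have -> : fsupport (fun=> 0 : R) = set0 :> set 'rV[R]_N.
    rewrite /fsupport (_ : [set _ | _] = set0) ?closure0//.
    by apply/seteqP; split=> y //=; rewrite eqxx.
  by [].
- by move=> x _ /=; rewrite normr0 powR0// gt_eqF.
Qed.

End test_fun_W1p.

(** * A finite [calE] belongs to the spectrum *)

Section ground_level.
Context (R : realType) (N : nat) (p : R) (Omega : set 'rV[R]_N).
Hypotheses (p_gt1 : 1 < p) (open_Omega : open Omega).

Notation mu := (lebesgue_rV R N).
Notation ext r := (Omega `\` closure (eball r)).

Let p0 : 0 < p. Proof. exact: lt_trans p_gt1. Qed.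

Let mO : measurable Omega. Proof. exact: open_measurable_rV. Qed.

Let mext (r : R) : measurable (ext r).
Proof. by apply: open_measurable_rV; apply: open_setD_ball. Qed.

Lemma lambda_p_ge0 (A : set 'rV[R]_N) : (0 <= lambda_p p A)%E.
Proof.
apply: le_ereal_inf_tmp => _ [f _ <-]; apply: integral_ge0 => x _.
by rewrite lee_fin powR_ge0.
Qed.

Lemma lambda_p_le_calE (r : R) : 0 < r -> (lambda_p p (ext r) <= calE p Omega)%E.
Proof. by move=> r0; apply: ereal_sup_ubound; exists r. Qed.

Lemma calE_fin : (calE p Omega < +oo)%E -> exists2 E : R, 0 <= E & calE p Omega = E%:E.
Proof.
have := le_trans (lambda_p_ge0 _) (lambda_p_le_calE ltr01).
by case: (calE p Omega) => [E| |]//; rewrite lee_fin => E0 _; exists E.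
Qed.

Lemma lambda_p_fin (E r : R) : calE p Omega = E%:E -> 0 < r ->
  exists l : R, [/\ lambda_p p (ext r) = l%:E, 0 <= l & l <= E].
Proof.
move=> EE r0; have := lambda_p_le_calE r0; rewrite EE.
have := lambda_p_ge0 (ext r).
by case: (lambda_p _ _) => [l| |]//; rewrite !lee_fin => l0 lE; exists l.
Qed.

Lemma almost_minimizer (E r e : R) : calE p Omega = E%:E -> 0 < r -> 0 < e ->
  exists v, [/\ test_fun (ext r) v,
    Lp_power mu Omega p (fun x => `|v x|) = 1 &
    Lp_power mu Omega p (fun x => enorm (gradient v x)) <= E + e].
Proof.
move=> EE r0 e0; have [l [ll l0 lE]] := lambda_p_fin EE r0.
have lfin : lambda_p p (ext r) \is a fin_num by rewrite ll.
have [_ [v [tv v1] <-]] := lb_ereal_inf_adherent e0 lfin.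
rewrite -/(lambda_p p (ext r)) ll.
have Lv := test_fun_Lp p_gt1 (mext r) tv.
have Ldv := test_fun_gradient_Lp p_gt1 (mext r) tv.
rewrite (int_vecE (mext r) Ldv) -EFinD lte_fin => h.
move: v1; rewrite (int_funE (mext r) Lv) => -[v1].
exists v; split => //.
  rewrite -v1; apply/esym; apply: (Lp_power_restrict p_gt1 mu (@subDsetl _ _ _)).
  by move=> x /(test_fun_eq0 tv) ->; rewrite normr0.
rewrite -(Lp_power_restrict p_gt1 mu (@subDsetl _ Omega (closure (eball r)))).
  by apply: le_trans (ltW h) _; rewrite lerD2r.
by move=> x /(test_fun_gradient_eq0 tv) ->; rewrite enorm0.
Qed.

(** The supremum is approached at one radius, and monotonicity extends the bound to all larger
    ones. *)
Lemma lambda_p_near_calE (E e : R) : calE p Omega = E%:E -> 0 < e ->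
  \forall n \near \oo, ((E - e)%:E <= lambda_p p (ext n.+1%:R))%E.
Proof.
move=> EE e0; have Efin : calE p Omega \is a fin_num by rewrite EE.
have [_ [r /= r0 <-]] := ub_ereal_sup_adherent e0 Efin.
rewrite -/(calE p Omega) EE -EFinB => h.
near=> n; apply: le_trans (ltW h) _; apply: (lambda_p_exterior_nd p_gt1 open_Omega).
apply: ltW; apply: lt_le_trans (truncnS_gt r) _; rewrite ler_nat ltnS.
by near: n; exact: nbhs_infty_ge.
Unshelve. all: by end_near. Qed.

Theorem essential_spectrum_calE (E : R) : calE p Omega = E%:E ->
  essential_spectrum p Omega E.
Proof.
move=> EE; have [l1 [_ l10 l1E]] := lambda_p_fin EE ltr01.
have E0 : 0 <= E := le_trans l10 l1E.
(* The functions live beyond the radius 2 (n + 1), so that [almost_critical] applies with the radius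
   n + 1, which is at least 1. *)
have r2 n : 0 < 2 * n.+1%:R :> R by exact: mulr_gt0.
have ne n : 0 < n.+1%:R^-1 :> R by rewrite invr_gt0.
have /choice[v Hv] := fun n => almost_minimizer EE (r2 n) (ne n).
have tv n : test_fun (ext (2 * n.+1%:R)) (v n) by have [] := Hv n.
have v1 n : Lp_power mu Omega p (fun x => `|v n x|) = 1 by have [] := Hv n.
have dv n : Lp_power mu Omega p (fun x => enorm (gradient (v n) x)) <= E + n.+1%:R^-1.
  by have [] := Hv n.
have tvO n : test_fun Omega (v n) := test_funW (@subDsetl _ _ _) (tv n).
have n_small (e : R) : 0 < e -> \forall n \near \oo, n.+1%:R^-1 <= e.
  move=> e0; near=> n; apply: ltW; near: n.
  exact: (near_infty_natSinv_lt (PosNum e0)).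
exists (fun n => test_W1p p_gt1 open_Omega (tvO n)); last first.
  (* For n large the n-th function vanishes on the whole ball of radius [r], so the norms are
     eventually equal to 0. *)
  move=> r r0; apply: (@cvg_near_cst _ _ _ _ _ _ _).
  near=> n; rewrite /Lp_norm /int_fun integral0_eq ?poweR0r ?invr_eq0 ?gt_eqF//.
  move=> x [Ox xr] /=; rewrite (test_fun_eq0 (tv n)) ?normr0 ?powR0 ?gt_eqF// => -[_]; apply.
  apply: subset_closure; apply: lt_le_trans xr _.
  apply: (@le_trans _ _ n.+1%:R); last by rewrite ler_peMl ?ler1n.
  apply: ltW; apply: lt_le_trans (truncnS_gt r) _; rewrite ler_nat ltnS.
  by near: n; exact: nbhs_infty_ge.
have Ldv n := test_fun_gradient_Lp p_gt1 mO (tvO n).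
split.
- by move=> n; exact: test_W1p_W01p.
- move=> n; rewrite /Lp_norm (int_funE mO (test_fun_Lp p_gt1 mO (tvO n))).
  by rewrite v1 poweR1r.
- apply: cvg_EFin.
    by near=> n; rewrite (int_vecE mO (Ldv n)).
  rewrite (_ : _ \o _ = fun n =>
    Lp_power mu Omega p (fun x => enorm (gradient (v n) x))); last first.
    by apply/funext => n; rewrite /= (int_vecE mO (Ldv n)).
  apply/cvgrPdist_le => e e0; near=> n.
  have h1 : n.+1%:R^-1 <= e by near: n; exact: n_small.
  have h2 : ((E - e)%:E <= lambda_p p (ext n.+1%:R))%E.
    by near: n; exact: lambda_p_near_calE.
  have h3 : ((E - e)%:E <= lambda_p p (ext (2 * n.+1%:R)))%E.
    apply: le_trans h2 _; apply: (lambda_p_exterior_nd p_gt1 open_Omega).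
    by rewrite ler_peMl ?ler1n.
  have := lambda_p_le p_gt1 (mext _) mO (@subDsetl _ _ _) h3 (tv n).
  rewrite v1 mulr1; move: (dv n) h1; set a := Lp_power _ _ _ _; set b := n.+1%:R^-1.
  by move=> h1 h5 h4; rewrite ler_norml; apply/andP; split; lra.
- pose J n (phi : W1p p Omega) : R :=
    minus_plaplacian (test_W1p p_gt1 open_Omega (tvO n)) phi -
    E * power_functional (test_W1p p_gt1 open_Omega (tvO n)) phi.
  rewrite -[X in X @ _ --> _]/(fun n => W01p_dual_norm (J n)).
  have ub (e0 : R) : 0 < e0 -> \forall n \near \oo, (W01p_dual_norm (J n) <= e0%:E)%E.
    move=> e00; have [dl dl0 Hdl] := almost_critical p_gt1 open_Omega E0 e00.
    near=> n; apply: ub_ereal_sup => _ [phi [Wphi phi1] <-]; rewrite lee_fin.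
    have n0 : 0 < n.+1%:R :> R by rewrite ltr0n.
    have [l [ll l0 lE]] := lambda_p_fin EE n0.
    have h1 : n.+1%:R^-1 <= dl by near: n; exact: n_small.
    have h2 : ((E - dl)%:E <= lambda_p p (ext n.+1%:R))%E.
      by near: n; exact: lambda_p_near_calE.
    have El : E - l <= dl by move: h2; rewrite ll lee_fin; lra.
    have hl : (l%:E <= lambda_p p (ext n.+1%:R))%E by rewrite ll.
    have n1 : 1 <= n.+1%:R :> R by rewrite ler1n.
    have dvn := le_trans (dv n) (lerD (lexx E) h1).
    have phi1' := W1p_norm_le1 p_gt1 open_Omega (W1p_fun_Lp_fun phi) (wgrad_Lp_fun phi) phi1.
    apply: le_trans (Hdl _ _ _ _ n1 l0 lE El hl (tv n) (v1 n) dvn Wphi phi1').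
    rewrite le_eqVlt; apply/orP; left; apply/eqP; congr (`| _ - E * _ |).
    by rewrite /pairing; apply: eq_Rintegral => x _ /=; rewrite mulrA.
  apply: cvg_EFin.
    (* The bound [ub] with [e0 = 1] makes the dual norms eventually finite, so that the convergence
       can be checked on reals. *)
    near=> n; rewrite ge0_fin_numE; last exact: W01p_dual_norm_ge0.
    by apply: (@le_lt_trans _ _ 1%:E); [near: n; exact: ub|rewrite ltry].
  apply/cvgr0Pnorm_le => e0 e00; near=> n => /=.
  have h : (W01p_dual_norm (J n) <= e0%:E)%E by near: n; exact: ub.
  move: h; have := W01p_dual_norm_ge0 p_gt1 open_Omega (J n).
  case: (W01p_dual_norm _) => [a| |]//=; rewrite !lee_fin => a0 ae.
  by rewrite ger0_norm.
Unshelve. all: by end_near. Qed.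

Lemma calE_le_essential_spectrum (m : R) : essential_spectrum p Omega m ->
  (calE p Omega <= m%:E)%E.
Proof. by move=> Sm; apply: ub_ereal_sup => _ [r r0 <-]; exact: essential_spectrum_ge. Qed.

End ground_level.

Theorem mainTheorem1 (R : realType) (N : nat) (p : R) (Omega : set 'rV[R]_N)
    (p_gt1 : 1 < p) (open_Omega : open Omega) :
  calE p Omega = ereal_inf [set l%:E | l in essential_spectrum p Omega] /\
  ((calE p Omega < +oo)%E ->
    exists l : R, [/\ calE p Omega = l%:E, essential_spectrum p Omega l &
      forall m : R, essential_spectrum p Omega m -> l <= m]).
Proof.
have lb m := @calE_le_essential_spectrum R N p Omega p_gt1 open_Omega m.
split; last first.
  move=> /calE_fin[E E0 EE]; exists E; split=> //; first exact: essential_spectrum_calE.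
  by move=> m /lb; rewrite EE lee_fin.
apply/eqP; rewrite eq_le; apply/andP; split.
  by apply: le_ereal_inf_tmp => _ [m Sm <-]; exact: lb.
(* If [calE] is finite, it is one of the levels over which the infimum is taken; if it is [+oo], the
   remaining inequality is trivial. *)
have [/calE_fin[E E0 EE]|] := ltP (calE p Omega) +oo%E; last exact: le_trans (leey _).
by rewrite EE; apply: ereal_inf_lbound; exists E => //; exact: essential_spectrum_calE.
Qed.
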